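(* For every integer $n\geq 0$, the map $H\mapsto \mathrm{sign}(H)$ induces a bijection between the set of isomorphism classes of distinguished t-hexagons of perimeter $2n$ and the set $I(n\mathbf{e}(1))\subset\Lambda_3$.
   Context: Triangular tiling: consider the regular tiling of the Euclidean plane by equilateral triangles of side length $1$, with one family of tiling lines horizontal; the tiling lines form three parallel families (the horizontal lines and their rotations by $\pi/3$ and by $2\pi/3$). A tiling strip of a family is the closed region between two (possibly equal) tiling lines of that family. A t-hexagon is a nonempty intersection of three tiling strips, one from each family; it is a vertex of the tiling, a segment of a tiling line, or a convex polygon with $3$ to $6$ sides. Its perimeter is the perimeter as a polygon, where a point has perimeter $0$ and a segment has perimeter twice its length. Two t-hexagons are isomorphic if some isometry of the plane mapping the tiling onto itself maps one onto the other. Character: traverse the boundary of a t-hexagon $H$ clockwise, starting at the right endpoint of its lowest horizontal side (the intersection of $H$ with the lowest horizontal line meeting $H$), moving successively in the directions making angles $\pi$, $2\pi/3$, $\pi/3$, $0$, $-\pi/3$, $-2\pi/3$ with the positive horizontal axis; let $a_1,\dots,a_6\in\mathbb{Z}_{\geq0}$ be the lengths of these successive moves (some may be $0$). The character is $\chi(H)=(a_1,\dots,a_6)$. $H$ is distinguished if $a_1+a_3+a_5\leq a_2+a_4+a_6$ and $a_1\geq a_3\geq a_5$. The signature of a distinguished $H$ is $\mathrm{sign}(H)=(a_1-a_3,\,a_3-a_5,\,a_5)\in\mathbb{Z}_{\geq0}^3$. Poset: $\Lambda_3=\mathbb{Z}_{\geq 0}^3$ with basis $\mathbf{e}(1),\mathbf{e}(2),\mathbf{e}(3)$;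 $X_3=\{(1,-2,0),(-2,1,0),(-1,-1,1),(0,0,-1)\}$; for $\mathbf{v},\mathbf{w}\in\Lambda_3$, $\mathbf{v}\lessdot\mathbf{w}$ if $\mathbf{v}-\mathbf{w}\in X_3$; $\prec$ is the transitive closure of $\lessdot$ on $\Lambda_3$ (chains staying in $\Lambda_3$); $I(\mathbf{v})=\{\mathbf{v}\}\cup\{\mathbf{w}\in\Lambda_3:\mathbf{w}\prec\mathbf{v}\}$. *)

(* Defs.v *)
From mathcomp Require Import all_boot all_order all_algebra.
From mathcomp Require Import all_classical all_reals all_analysis.
From Stdlib Require Import Relation_Operators.

Set Implicit Arguments.
Unset Strict Implicit.
Unset Printing Implicit Defensive.

Import Order.TTheory GRing.Theory Num.Theory.
Import numFieldNormedType.Exports.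

Local Open Scope classical_set_scope.
Local Open Scope ring_scope.

Section Geometry.
Variable R : realType.

Definition plane : Type := (R^o * R^o)%type.

Implicit Types (p q r : plane) (H K S T : set plane).

(* Euclidean distance; the library norm on a product is the sup norm, which is
   only used here through the topology it induces. *)
Definition dist p q : R := Num.sqrt ((p.1 - q.1) ^+ 2 + (p.2 - q.2) ^+ 2).

Definition direction (t : R) : plane := (cos t, sin t).

Definition rotation (t : R) (p : plane) : plane :=
  (cos t * p.1 - sin t * p.2, sin t * p.1 + cos t * p.2).

Definition segment p q : set plane :=
  [set p + t *: (q - p) | t in [set t : R | 0 <= t <= 1]].

Definition triangle p q r : set plane :=
  [set x | exists s t : R, [/\ 0 <= s, 0 <= t, s + t <= 1
                           & x = p + s *: (q - p) + t *: (r - p)]].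

Definition boundary S : set plane := closure S `\` interior S.

Definition diameter S : R := sup [set dist x.1 x.2 | x in S `*` S].

(* Height of the unit equilateral triangle. *)
Definition height : R := Num.sqrt 3 / 2.

Definition horizontal_line (k : int) : set plane :=
  [set p | p.2 = k%:~R * height].

Definition horizontal_strip (k l : int) : set plane :=
  [set p | k%:~R * height <= p.2 <= l%:~R * height].

(* The three families i = 0, 1, 2 are the horizontal family rotated about the
   origin by i * pi / 3; the origin is a vertex of the tiling. *)
Definition tiling_line (i : 'I_3) (k : int) : set plane :=
  rotation (i%:R * pi / 3) @` horizontal_line k.

(* The region between the lines k and l of family i, used with k <= l. *)
Definition tiling_strip (i : 'I_3) (k l : int) : set plane :=
  rotation (i%:R * pi / 3) @` horizontal_strip k l.

Definition tiling_vertex p : Prop :=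
  forall i : 'I_3, exists k : int, tiling_line i k p.

Definition tiling : set (set plane) :=
  [set T | exists p q r,
     [/\ tiling_vertex p, tiling_vertex q & tiling_vertex r] /\
     [/\ dist p q = 1, dist q r = 1, dist r p = 1 & T = triangle p q r]].

Definition thexagon H : Prop :=
  H !=set0 /\
  exists k l : 'I_3 -> int, (forall i, k i <= l i) /\
    H = \bigcap_(i in [set: 'I_3]) tiling_strip i (k i) (l i).

Definition side H S : Prop :=
  exists (u : plane) (c : R),
    [/\ u != 0,
        (forall p, H p -> u.1 * p.1 + u.2 * p.2 <= c),
        S = H `&` [set p | u.1 * p.1 + u.2 * p.2 = c]
      & exists p q, [/\ S p, S q & p != q]].

(* A t-hexagon with empty interior is a point or a segment. *)
Definition perimeter H : R :=
  if `[< interior H = set0 >] then 2 * diameter H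
  else \sum_(S \in [set S | side H S]) diameter S.

Definition plane_isometry (f : plane -> plane) : Prop :=
  forall p q, dist (f p) (f q) = dist p q.

Definition tiling_symmetry (f : plane -> plane) : Prop :=
  plane_isometry f /\ [set f @` T | T in tiling] = tiling.

Definition isomorphic H K : Prop :=
  exists f, tiling_symmetry f /\ f @` H = K.

Definition isomorphism_class (A : set (set plane)) H : set (set plane) :=
  [set K | A K /\ isomorphic H K].

Definition isomorphism_classes (A : set (set plane)) : set (set (set plane)) :=
  [set isomorphism_class A H | H in A].

(* Right endpoint of the lowest horizontal side, which may be a single point. *)
Definition start_point H p : Prop :=
  exists k : int,
    [/\ forall j : int, H `&` horizontal_line j !=set0 -> k <= j,
        (H `&` horizontal_line k) p
      & forall q, (H `&` horizontal_line k) q -> q.1 <= p.1].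

(* a_m, for the 1-based index m of the sequence a_1, ..., a_6 *)
Definition entry (a : 6.-tuple nat) (m : nat) : nat := nth 0%N a m.-1.

(* Position after the first m moves from p; move j + 1 has length a_(j+1) and
   direction pi - j * pi / 3. *)
Definition walk p (a : 6.-tuple nat) (m : nat) : plane :=
  p + \sum_(j < m) (entry a j.+1)%:R *: direction (pi - j%:R * pi / 3).

(* The moves go once around the boundary of H; if H is a point or a segment,
   its boundary is H itself and a segment is run through in both directions. *)
Definition traverses_boundary H (a : 6.-tuple nat) : Prop :=
  exists p,
    [/\ start_point H p, walk p a 6 = p
      & boundary H =
        \bigcup_(j in [set: 'I_6]) segment (walk p a j) (walk p a j.+1)].

(* Every t-hexagon has exactly one such tuple; the default is irrelevant. *)
Definition character H : 6.-tuple nat :=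
  xget [tuple of nseq 6 0%N] [set a | traverses_boundary H a].

Definition distinguished H : Prop :=
  let a := entry (character H) in
  [/\ (a 1 + a 3 + a 5 <= a 2 + a 4 + a 6)%N, (a 3 <= a 1)%N & (a 5 <= a 3)%N].

Definition Lambda3 : Type := (nat * nat * nat)%type.

(* The truncated subtractions are exact when H is distinguished. *)
Definition signature H : Lambda3 :=
  let a := entry (character H) in ((a 1 - a 3)%N, (a 3 - a 5)%N, a 5).

Definition distinguished_thexagons (n : nat) : set (set plane) :=
  [set H | [/\ thexagon H, distinguished H & perimeter H = (2 * n)%:R]].

End Geometry.

Definition e1 : Lambda3 := (1%N, 0%N, 0%N).

Definition X3 : seq (int * int * int) :=
  [:: (1, -2, 0); (-2, 1, 0); (-1, -1, 1); (0, 0, -1)].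

Definition to_int3 (v : Lambda3) : int * int * int :=
  (v.1.1%:Z, v.1.2%:Z, v.2%:Z).

Definition covered (v w : Lambda3) : Prop := to_int3 v - to_int3 w \in X3.

Definition prec : Lambda3 -> Lambda3 -> Prop := clos_trans Lambda3 covered.

Definition lower_ideal (v : Lambda3) : set Lambda3 :=
  [set w | w = v \/ prec w v].

(* Main.v *)
(* Let [U_0, ..., U_5] be the linear forms measuring, in units of the height of
   a tile, how far a point lies in the six outer normal directions; they satisfy
   [U_(j+2) = U_(j+1) - U_j].  A t-hexagon is the set of points with
   [U_j <= h_j] for integers [h_j], which may be taken to be the maxima of the
   [U_j].  Its boundary walk has the side lengths
   [a_(j+1) = h_(j-1) + h_(j+1) - h_j] (indices of [h] modulo 6), and the perimeter
   is their sum.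

   The walk closes up iff [a_1 + a_2 = a_4 + a_5] and [a_2 + a_3 = a_5 + a_6], so
   [a_4 - a_1 = a_6 - a_3 = a_2 - a_5] is a number [d] with
   [2 (a_1 + a_3 + a_5) + 3 d = 2 n].  Hence [d = 2 e] and the signature
   [(x, y, z)] satisfies [x + 2 y + 3 z + 3 e = n] with [e >= 0] when the hexagon
   is distinguished; together with [n] it determines the [a_j], and thereby the
   hexagon up to a translation.  The triples arising in this way are exactly those
   of the ideal, since the elements of [X3] change [x + 2 y + 3 z] by [0] or [-3].

   The linear part of a symmetry of the tiling sends unit lattice vectors to unit
   lattice vectors, so it permutes the [U_j] by an element of the dihedral group of
   order 12, and the [a_j] are permuted accordingly.  A dihedral permutation taking
   one distinguished character to another preserves the signature. *)

Require Import Defs.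
From mathcomp Require Import all_boot all_order all_algebra.
From mathcomp Require Import all_classical all_reals all_analysis.
From mathcomp Require Import ring lra zify.

Set Implicit Arguments.
Unset Strict Implicit.
Unset Printing Implicit Defensive.

Import Order.TTheory GRing.Theory Num.Theory.
Import numFieldNormedType.Exports.

Local Open Scope classical_set_scope.
Local Open Scope ring_scope.

(** * Sequences with [u j.+2 = u j.+1 - u j], and periodic sequences *)

Lemma hexrec_ext (V : zmodType) (u v : nat -> V) :
  (forall j, u j.+2 = u j.+1 - u j) -> (forall j, v j.+2 = v j.+1 - v j) ->
  u 0%N = v 0%N -> u 1%N = v 1%N -> forall j, u j = v j.
Proof.
move=> hu hv h0 h1 j; suff [] : u j = v j /\ u j.+1 = v j.+1 by [].
by elim: j => [//|j [IH0 IH1]]; split=> //; rewrite hu hv IH0 IH1.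
Qed.

Lemma hexrec_opp (V : zmodType) (u : nat -> V) :
  (forall j, u j.+2 = u j.+1 - u j) -> forall j, u (j + 3)%N = - u j.
Proof. by move=> hu j; rewrite addn3 !hu addrAC subrr add0r. Qed.

Lemma hexrec_periodic (V : zmodType) (u : nat -> V) :
  (forall j, u j.+2 = u j.+1 - u j) -> forall j, u (j + 6)%N = u j.
Proof.
by move=> hu j; rewrite -[6%N]/(3 + 3)%N addnA !hexrec_opp ?opprK.
Qed.

Lemma periodic_addM (T : Type) (u : nat -> T) c :
  (forall j, u (j + c)%N = u j) -> forall q j, u (j + q * c)%N = u j.
Proof.
move=> hu; elim=> [|q IH] j; first by rewrite mul0n addn0.
by rewrite mulSn addnA IH hu.
Qed.

Lemma periodic_mod (T : Type) (u : nat -> T) c :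
  (forall j, u (j + c)%N = u j) -> forall j, u j = u (j %% c)%N.
Proof.
by move=> hu j; rewrite {1}(divn_eq j c) addnC (periodic_addM hu).
Qed.

(** * The six directions and the six linear forms *)

Section Coordinates.
Variable R : realType.
Implicit Types (p q : plane R) (j : nat).

Notation ht := (@height R).

Lemma height_gt0 : 0 < ht.
Proof. by rewrite /height divr_gt0 // sqrtr_gt0. Qed.

Lemma height_sqr : ht ^+ 2 = 3 / 4.
Proof. by rewrite /height expr_div_n sqr_sqrtr //; lra. Qed.

Lemma height_neq0 : ht != 0. Proof. by rewrite gt_eqF // height_gt0. Qed.

Lemma cos_pi3 : cos (pi / 3) = 2^-1 :> R.
Proof.
set c := cos _.
have c_gt0 : 0 < c.
  apply: cos_gt0_pihalf; have := pi_gt0 R.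
  by move=> ?; apply/andP; split; lra.
(* The triple angle formula at [pi / 3] gives [4 c^3 - 3 c + 1 = 0], which factors in this way;
   [c > 0] excludes the root [-1]. *)
have /eqP : (c + 1) * (2 * c - 1) ^+ 2 = 0.
  have : cos (pi / 3 + (pi / 3 + pi / 3)) = -1 :> R.
    by rewrite -cospi; congr cos; lra.
  rewrite !cosD !sinD -/c.
  have := cos2Dsin2 (pi / 3 : R); rewrite -/c; set s := sin _ => cs E.
  have E1 : s ^+ 2 = 1 - c ^+ 2 by rewrite -cs; ring.
  have E2 : c * (c * c - s * s) - s * (s * c + c * s) = c ^+ 3 - 3 * c * s ^+ 2.
    by ring.
  transitivity (c ^+ 3 - 3 * c * (1 - c ^+ 2) + 1); first by ring.
  by rewrite -E1 -E2 E; ring.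
rewrite mulf_eq0 sqrf_eq0 => /orP[] /eqP h; lra.
Qed.

Lemma sin_pi3 : sin (pi / 3) = ht.
Proof.
have s_ge0 : 0 <= sin (pi / 3 : R).
  apply: sin_ge0_pi; have := pi_gt0 R.
  by move=> ?; apply/andP; split; lra.
apply/eqP; rewrite -(eqrXn2 (n := 2)) // ?(ltW height_gt0) // height_sqr.
have := cos2Dsin2 (pi / 3 : R); rewrite cos_pi3 => h.
by apply/eqP; lra.
Qed.

Definition dir (j : nat) : plane R := direction (pi - j%:R * pi / 3).

(* [outward j] vanishes on [dir j], takes the value 1 on [dir j.+1] and hence
   is maximal on a t-hexagon along the (j+1)-st side of the boundary walk. *)
Fixpoint outward (j : nat) (p : plane R) : R :=
  match j with
  | 0 => - (p.2 / ht)
  | 1 => - (p.1 + p.2 / (2 * ht))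
  | (k.+1 as j').+1 => outward j' p - outward k p
  end.

Lemma plane_eq p q : p.1 = q.1 -> p.2 = q.2 -> p = q.
Proof. by case: p q => ? ? [? ?] /= -> ->. Qed.

Lemma dirSS j : dir j.+2 = dir j.+1 - dir j.
Proof.
have E1 : pi - j.+2%:R * pi / 3 = (pi - j.+1%:R * pi / 3) - pi / 3 :> R.
  by rewrite -[j.+2%:R]natr1; ring.
have E2 : pi - j%:R * pi / 3 = (pi - j.+1%:R * pi / 3) + pi / 3 :> R.
  by rewrite -[j.+1%:R]natr1; ring.
apply: plane_eq; rewrite /dir /= E1 E2 ?(cosB, cosD, sinB, sinD) cos_pi3 sin_pi3.
  by field.
by field.
Qed.

Lemma dir0 : dir 0 = (-1, 0).
Proof. by rewrite /dir /direction !mul0r subr0 cospi sinpi. Qed.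

Lemma dir1 : dir 1 = (- 2^-1, ht).
Proof.
rewrite /dir /direction !mul1r cosB sinB cospi sinpi cos_pi3 sin_pi3.
by congr pair; ring.
Qed.

Lemma dir_periodic j : dir (j + 6) = dir j.
Proof. exact: hexrec_periodic dirSS j. Qed.

Lemma outwardSS j p : outward j.+2 p = outward j.+1 p - outward j p.
Proof. by []. Qed.

Lemma outward_opp j p : outward (j + 3) p = - outward j p.
Proof. exact: (hexrec_opp (fun j => outwardSS j p)). Qed.

Lemma outward_periodic j p : outward (j + 6) p = outward j p.
Proof. exact: (hexrec_periodic (fun j => outwardSS j p)). Qed.

Lemma outwardD j p q : outward j (p + q) = outward j p + outward j q.
Proof.
move: j; apply: (hexrec_ext (fun j => outwardSS j _)).
- by move=> j; rewrite !outwardSS; ring.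
- by rewrite /=; ring.
- by rewrite /=; ring.
Qed.

Lemma outwardZ j t p : outward j (t *: p) = t * outward j p.
Proof.
move: j; apply: (hexrec_ext (fun j => outwardSS j _)).
- by move=> j; rewrite !outwardSS; ring.
- by rewrite /= /GRing.scale /=; ring.
- by rewrite /= /GRing.scale /=; ring.
Qed.

Lemma outwardN j p : outward j (- p) = - outward j p.
Proof. by rewrite -scaleN1r outwardZ mulN1r. Qed.

Lemma outwardB j p q : outward j (p - q) = outward j p - outward j q.
Proof. by rewrite outwardD outwardN. Qed.

Lemma outward0 j : outward j 0 = 0.
Proof. by rewrite -(scale0r 0) outwardZ mul0r. Qed.

Lemma outward_dir j :
  [/\ outward j (dir j) = 0, outward j.+1 (dir j) = 1,
      outward j (dir j.+1) = -1 & outward j.+1 (dir j.+1) = 0].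
Proof.
have h0 := height_neq0.
elim: j => [|j [IH1 IH2 IH3 IH4]].
  rewrite dir0 dir1 /= !mul0r addr0 divff //.
  by split=> //; try (by field); ring.
rewrite dirSS !outwardB !outwardSS IH1 IH2 IH3 IH4.
by split=> //; ring.
Qed.

(** By [outward_dir], the forms [outward j.+1] and [- outward j] are the basis dual to [dir j],
    [dir j.+1]. *)
Lemma outwardK j p :
  p = outward j.+1 p *: dir j - outward j p *: dir j.+1.
Proof.
elim: j => [|j IH].
  rewrite dir0 dir1 /=; have h0 := height_neq0.
  by apply: plane_eq; rewrite /= /GRing.scale /=; field.
by rewrite outwardSS dirSS scalerBl scalerBr opprB [RHS]addrC addrA subrK.
Qed.

Lemma outward_inj j p q :
  outward j p = outward j q -> outward j.+1 p = outward j.+1 q -> p = q.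
Proof. by move=> h0 h1; rewrite (outwardK j p) (outwardK j q) h0 h1. Qed.

(** The form [x^2 - x y + y^2] is invariant under [(x, y) -> (y, y - x)], the passage from [j] to
    [j.+1]. *)
Lemma normE j p : p.1 ^+ 2 + p.2 ^+ 2 =
  outward j p ^+ 2 - outward j p * outward j.+1 p + outward j.+1 p ^+ 2.
Proof.
elim: j => [|j ->]; last by rewrite outwardSS; ring.
have h0 := height_neq0; have h2 := height_sqr.
rewrite /=; transitivity (p.1 ^+ 2 + p.2 ^+ 2 * (3 / 4) / ht ^+ 2).
  by rewrite h2; field.
by field.
Qed.

Lemma distE j p q : dist p q =
  Num.sqrt (outward j (p - q) ^+ 2 - outward j (p - q) * outward j.+1 (p - q)
            + outward j.+1 (p - q) ^+ 2).
Proof. by rewrite -normE. Qed.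

End Coordinates.
Arguments outward : simpl never.

Lemma periodic6_ind (P : nat -> Prop) : (forall i, P (i + 6)%N = P i) ->
  forall j, P j -> P j.+1 -> P j.+2 -> P j.+3 -> P j.+4 -> P j.+4.+1 ->
  forall i, P i.
Proof.
move=> per j P0 P1 P2 P3 P4 P5 i.
have shift r : ((j + r) %% 6 = i %% 6)%N -> P (j + r)%N -> P i.
  by move=> e; rewrite (periodic_mod per) e -(periodic_mod per).
have [r r6 e] : exists2 r, (r < 6)%N & ((j + r) %% 6 = i %% 6)%N.
  (* Modulo 6, [5 * j] is [- j]. *)
  exists ((i + 5 * j) %% 6)%N; first by rewrite ltn_mod.
  by rewrite modnDmr; lia.
by move/shift: e; move: r r6 => [|[|[|[|[|[|//]]]]]] _;
  rewrite ?addnS ?addn0; apply.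
Qed.

Lemma addn6 j : (j + 6 = j.+4.+2)%N. Proof. by rewrite !addnS addn0. Qed.

(** * Hexagons given by support values *)

Section Hexagons.
Variable R : realType.
Implicit Types (p q : plane R) (j : nat) (h : nat -> R).

Definition hexagon h : set (plane R) := [set p | forall j, outward j p <= h j].

(* The values [h] of the support function of a nonempty t-hexagon at the six
   outer normals, extended periodically; the inequality says that none of the
   constraints defining [hexagon h] is redundant. *)
Definition tight h : Prop :=
  (forall j, h (j + 6)%N = h j) /\ (forall j, h j.+1 <= h j + h j.+2).

(** By [outwardK], the common point of the lines [outward j = h j] and [outward j.+1 = h j.+1]. *)
Definition vertex h j : plane R := h j.+1 *: dir R j - h j *: dir R j.+1.

(* The length of the side between [vertex h j] and [vertex h j.+1]; the entry
   [a_(j+1)] of the character is [edge h (j + 5)]. *)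
Definition edge h j : R := h j + h j.+2 - h j.+1.

Lemma edge_ge0 h j : tight h -> 0 <= edge h j.
Proof. by case=> _ /(_ j); rewrite /edge subr_ge0. Qed.

Lemma outward_vertex h j : outward j (vertex h j) = h j.
Proof.
have [d0 d1 d2 d3] := outward_dir R j.
by rewrite /vertex outwardB !outwardZ d0 d2; ring.
Qed.

Lemma outwardS_vertex h j : outward j.+1 (vertex h j) = h j.+1.
Proof.
have [d0 d1 d2 d3] := outward_dir R j.
by rewrite /vertex outwardB !outwardZ d1 d3; ring.
Qed.

Lemma vertexS h j : vertex h j.+1 = vertex h j + edge h j *: dir R j.+1.
Proof.
apply: (@outward_inj _ j.+1); have [d0 d1 d2 d3] := outward_dir R j.+1.
  by rewrite outward_vertex outwardD outwardS_vertex outwardZ d0; ring.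
rewrite outwardS_vertex outwardD outwardZ outwardSS d1 outward_vertex.
by rewrite outwardS_vertex /edge; ring.
Qed.

Lemma vertexSB h j : vertex h j.+1 - vertex h j = edge h j *: dir R j.+1.
Proof. by rewrite vertexS [LHS]addrC addKr. Qed.

Lemma vertex_periodic h j : tight h -> vertex h (j + 6) = vertex h j.
Proof. by case=> per _; rewrite /vertex -!addSn !per !dir_periodic. Qed.

Lemma edge_periodic h j : tight h -> edge h (j + 6) = edge h j.
Proof. by case=> per _; rewrite /edge -!addSn !per. Qed.

Lemma hexagon_ind h p (per : forall j, h (j + 6)%N = h j) j :
  outward j p <= h j -> outward j.+1 p <= h j.+1 -> outward j.+2 p <= h j.+2 ->
  outward j.+3 p <= h j.+3 -> outward j.+4 p <= h j.+4 ->
  outward j.+4.+1 p <= h j.+4.+1 -> hexagon h p.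
Proof.
by apply: periodic6_ind => i; rewrite outward_periodic per.
Qed.

Lemma vertex_hexagon h j : tight h -> hexagon h (vertex h j).
Proof.
move=> [per subl]; have e0 := outward_vertex h j; have e1 := outwardS_vertex h j.
apply: (hexagon_ind per (j := j)); rewrite ?outwardSS ?e0 ?e1 //.
- by have := subl j.+1; have := subl j.+2; have := subl j; lra.
- by have := subl j.+1; have := subl j.+2; have := subl j; lra.
- by have := subl j.+1; have := subl j.+2; have := subl j.+3; lra.
- have := subl j.+4.+1; have := per j; have := per j.+1; rewrite !addn6.
  by move=> -> ->; lra.
Qed.

Lemma face_segment h j : tight h ->
  hexagon h `&` [set p | outward j.+1 p = h j.+1] =
  segment (vertex h j) (vertex h j.+1).
Proof.
move=> supp; have le0 := edge_ge0 j supp.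
have [d0 d1 d2 d3] := outward_dir R j.+1.
apply/seteqP; split=> p.
  (* [t] is the position of [p] along [dir j.+1], counted from [vertex h j], where [outward j.+2]
     takes the value [h j.+1 - h j]. *)
  move=> [hp /= ep]; set t := outward j.+2 p - (h j.+1 - h j).
  have t0 : 0 <= t by have := hp j; rewrite /t outwardSS ep; lra.
  have t1 : t <= edge h j by have := hp j.+2; rewrite /t /edge; lra.
  have pE : p = vertex h j + t *: dir R j.+1.
    apply: (@outward_inj _ j.+1).
      by rewrite outwardD outwardZ d0 outwardS_vertex ep; ring.
    rewrite outwardD outwardZ d1 [in RHS]outwardSS outwardS_vertex outward_vertex.
    by rewrite /t; ring.
  have [e0|ne0] := eqVneq (edge h j) 0.
    have t00 : t = 0 by lra.
    by exists 0; rewrite /= ?lexx ?ler01 // pE t00 !scale0r.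
  have e0 : 0 < edge h j by rewrite lt_def ne0.
  exists (t / edge h j) => /=.
    by rewrite divr_ge0 //= ler_pdivrMr // mul1r t1.
  by rewrite vertexSB scalerA divfK // pE.
move=> [t /= /andP[t0 t1] <-]; rewrite vertexSB; split=> /=; last first.
  by rewrite outwardD !outwardZ d0 outwardS_vertex; ring.
move=> i; have a := vertex_hexagon j supp i.
have b := vertex_hexagon j.+1 supp i; rewrite vertexS outwardD outwardZ in b.
rewrite outwardD !outwardZ.
set X := outward i (vertex h j) in a b *; set Y := edge h j * _ in b *.
suff: t * Y <= h i - X by lra.
have [Y0|Y0] := leP Y 0.
  by apply: (@le_trans _ _ 0); [exact: mulr_ge0_le0 | lra].
by apply: (@le_trans _ _ Y); [rewrite ler_piMl // ltW | lra].
Qed.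

Lemma width_ge0 h j : tight h -> 0 <= h j + h j.+3.
Proof. by case=> _ t; have := t j; have := t j.+1; lra. Qed.

(** [outward j] is the sum of the forms of indices [j - 1] and [j + 1], so the sum of their bounds
    bounds it too; [j.+4.+1] stands for [j - 1] modulo 6. *)
Definition tighten (g : nat -> R) j : R := Num.min (g j) (g j.+4.+1 + g j.+1).

Lemma tightenP (g : nat -> R) : (forall j, g (j + 6)%N = g j) ->
  hexagon g !=set0 -> tight (tighten g) /\ hexagon (tighten g) = hexagon g.
Proof.
move=> per [p gp]; have per6 i : g i.+4.+2 = g i by rewrite -addn6 per.
have opp i q : outward i.+3 q = - outward i q by rewrite -addn3 outward_opp.
have uper i q : outward i.+4.+2 q = outward i q by rewrite -addn6 outward_periodic.
split; first split.
- by move=> j; rewrite addn6 /tighten !per6.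
- move=> j; rewrite /tighten !per6.
  (* A point of the hexagon makes the widths nonnegative, and also [T], since the three forms
     involved add up to 0. [T] settles the case in which both neighbours were lowered, so one pass
     of tightening suffices. *)
  have w i : 0 <= g i + g i.+3 by have := gp i; have := gp i.+3; rewrite opp; lra.
  have w0 := w j; have w1 := w j.+1; have w2 := w j.+2.
  have w5 := w j.+4.+1; rewrite !per6 in w5.
  have T : 0 <= g j.+4.+1 + g j.+1 + g j.+3.
    have := gp j.+4.+1; have := gp j.+1; have := gp j.+3.
    by rewrite !opp !outwardSS; lra.
  by rewrite /Num.min; case: ifPn; rewrite -?leNgt => ?;
     case: ifPn; rewrite -?leNgt => ?; case: ifPn; rewrite -?leNgt => ?; lra.
- apply/seteqP; split=> q /= hq j; have := hq j; rewrite /tighten le_min.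
    by case/andP.
  move=> ->; have := hq j.+4.+1; have := hq j.+1.
  by rewrite !opp !outwardSS; lra.
Qed.

End Hexagons.

(** * t-hexagons as tight hexagons with integral support values; interior and boundary *)

Section Tiling.
Variable R : realType.
Implicit Types (p q : plane R) (j : nat) (h : nat -> R).

Lemma rotation_image (t : R) (S : set (plane R)) :
  rotation t @` S = [set p | S (rotation (- t) p)].
Proof.
have cs := cos2Dsin2 t.
have rotK s p : cos s ^+ 2 + sin s ^+ 2 = 1 -> rotation (- s) (rotation s p) = p.
  move=> cs1; apply: plane_eq; rewrite /rotation /= cosN sinN.
    by transitivity ((cos s ^+ 2 + sin s ^+ 2) * p.1); [ring | rewrite cs1 mul1r].
  by transitivity ((cos s ^+ 2 + sin s ^+ 2) * p.2); [ring | rewrite cs1 mul1r].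
apply/seteqP; split=> [_ [p Sp <-] /=|p /= Sp]; first by rewrite rotK.
exists (rotation (- t) p) => //.
by rewrite -{1}[t]opprK rotK // cosN sinN sqrrN.
Qed.

(** Hence [outward (3 - i)] numbers the lines of family [i]. Together with the opposite forms
    [outward (6 - i)], the three families use the indices 1 to 6. *)
Lemma rotation_outward (i : 'I_3) p :
  (rotation (- (i%:R * pi / 3)) p).2 = outward (3 - i) p * height R.
Proof.
have h0 := height_neq0 R; have h2 := height_sqr R.
case: i => [[|[|[|//]]]] ?; rewrite /rotation /= cosN sinN ?(subn0, subSS).
- by rewrite !mul0r sin0 cos0 !outwardSS /outward; field.
- by rewrite mul1r sin_pi3 cos_pi3 !outwardSS /outward; field.
- have -> : 2 * pi / 3 = pi / 3 + pi / 3 :> R by ring.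
  rewrite sinD cosD sin_pi3 cos_pi3 /outward.
  rewrite -[height R * height R]expr2 h2; field.
  by rewrite h0.
Qed.

Lemma tiling_lineE (i : 'I_3) (k : int) :
  tiling_line i k = [set p : plane R | outward (3 - i) p = k%:~R].
Proof.
rewrite /tiling_line rotation_image; apply/seteqP.
split=> p; have := rotation_outward i p; rewrite /horizontal_line /= => ->;
  last by move=> ->.
by apply: mulIf; exact: height_neq0.
Qed.

Lemma tiling_stripE (i : 'I_3) (k l : int) : tiling_strip i k l =
  [set p : plane R | outward (3 - i) p <= l%:~R /\ outward (6 - i) p <= - k%:~R].
Proof.
have h0 := height_gt0 R.
have opp p : outward (6 - i) p = - outward (3 - i) p.
  by rewrite -outward_opp; congr (outward _ p); have := ltn_ord i; lia.
rewrite /tiling_strip rotation_image; apply/seteqP.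
split=> p; have := rotation_outward i p; rewrite /horizontal_strip /= => ->;
  rewrite !ler_pM2r // opp lerN2.
  by move=> /andP[].
by move=> [-> ->].
Qed.

Lemma hexagon_bigcap h (k l : 'I_3 -> int) : (forall j, h (j + 6)%N = h j) ->
  (forall i : 'I_3, h (3 - i)%N = (l i)%:~R /\ h (6 - i)%N = - (k i)%:~R) ->
  \bigcap_(i in [set: 'I_3]) tiling_strip i (k i) (l i) = hexagon h.
Proof.
move=> per hkl; apply/seteqP; split=> p; last first.
  move=> hp i _; rewrite tiling_stripE /=; have [<- <-] := hkl i.
  by split; apply: hp.
move=> sp; have {}sp (i : 'I_3) :
    outward (3 - i) p <= h (3 - i)%N /\ outward (6 - i) p <= h (6 - i)%N.
  by have [-> ->] := hkl i; have := sp i I; rewrite tiling_stripE.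
have [a3 a6] := sp (inord 0); have [a2 a5] := sp (inord 1).
have [a1 a4] := sp (inord 2).
rewrite !inordK // ?(subn0, subSS) in a1 a2 a3 a4 a5 a6.
exact: (hexagon_ind per a1 a2 a3 a4 a5 a6).
Qed.

Lemma thexagonP (H : set (plane R)) : thexagon H <->
  exists h, [/\ tight h, (forall j, h j \is a Num.int) & H = hexagon h].
Proof.
split.
  move=> [Hne [k [l [_ HE]]]].
  (* The bounds at the indices 0 to 5: the upper line of family [i] bounds the form of index
     [3 - i], the lower one that of index [6 - i], with 6 stored at 0. *)
  pose s := [:: - (k (inord 0))%:~R; (l (inord 2))%:~R; (l (inord 1))%:~R;
               (l (inord 0))%:~R; - (k (inord 2))%:~R; - (k (inord 1))%:~R] : seq R.
  pose g j := nth 0 s (j %% 6).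
  have per j : g (j + 6)%N = g j by rewrite /g modnDr.
  have gint j : g j \is a Num.int.
    apply: (@all_nthP _ (fun x => x \is a Num.int) s 0 _ _ _).
      by rewrite /= !rpredN !intr_int.
    by rewrite ltn_mod.
  have gE : H = hexagon g.
    rewrite HE; apply: hexagon_bigcap => // i.
    have -> : i = inord i by rewrite inord_val.
    by case: i => [[|[|[|//]]]] i3; rewrite inordK.
  have [|sg sgE] := tightenP per; first by rewrite -gE.
  exists (tighten g); split=> //; last by rewrite sgE.
  by move=> j; rewrite /tighten; case: leP => // _; rewrite rpredD.
move=> [h [supp hint ->]]; split.
  by exists (vertex h 0); exact: vertex_hexagon.
exists (fun i => Num.floor (- h (6 - i)%N)), (fun i => Num.floor (h (3 - i)%N)).
split.
  move=> i; apply: le_floor; have := width_ge0 (3 - i) supp.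
  have -> : ((3 - i).+3 = 6 - i)%N by have := ltn_ord i; lia.
  by move=> ?; lra.
symmetry; apply: hexagon_bigcap; first by case: supp.
by move=> i; rewrite !floorK ?rpredN // opprK.
Qed.

Lemma outward_continuous j : continuous (outward j : plane R -> R^o).
Proof.
have c2 : continuous (fun p : plane R => p.2 : R^o) by move=> p; exact: cvg_snd.
have c1 : continuous (fun p : plane R => p.1 : R^o) by move=> p; exact: cvg_fst.
suff [] : continuous (outward j : plane R -> R^o) /\
          continuous (outward j.+1 : plane R -> R^o) by [].
elim: j => [|j [IH0 IH1]].
  split=> p; first by apply: cvgN; apply: cvgM; [exact: c2 | exact: cvg_cst].
  apply: cvgN; apply: cvgD; first exact: c1.
  by apply: cvgM; [exact: c2 | exact: cvg_cst].
by split=> // p; apply: cvgB; [exact: IH1 | exact: IH0].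
Qed.

Lemma hexagon_closed h : closed (hexagon h).
Proof.
have -> : hexagon h =
    \bigcap_(j in [set: nat]) (outward j @^-1` [set x : R^o | x <= h j]).
  apply/seteqP; split=> p; first by move=> hp j _; exact: hp.
  by move=> hp j; exact: hp.
apply: closed_bigI => j _.
by apply: closed_comp; [move=> p _; exact: outward_continuous | exact: closed_le].
Qed.

(** Serves to refute that a linear form on [A] is maximal at an interior point: a short move along
    [v], on which the form is positive, stays in [A]. *)
Lemma interior_ray (A : set (plane R)) p (v : plane R) :
  interior A p -> exists2 t, 0 < t & A (p + t *: v).
Proof.
move=> Ap; pose g (t : R^o) := p + t *: v : plane R.
have cg : g t @[t --> (0 : R^o)] --> p.
  rewrite -[X in _ --> X]addr0 -[X in _ + X](scale0r v).
  apply: cvgD; first exact: cvg_cst.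
  by apply: cvgZr_tmp; exact: cvg_id.
have /nbhs_ballP[e /= e0 sube] : \forall t \near (0 : R^o), A (g t).
  exact: cg Ap.
exists (e / 2); first by rewrite divr_gt0.
by apply: sube; rewrite /ball /= sub0r normrN gtr0_norm; lra.
Qed.

Lemma hexagon_interior h : (forall j, h (j + 6)%N = h j) ->
  interior (hexagon h) = [set p | forall j, outward j p < h j].
Proof.
move=> per; apply/seteqP; split=> p /=.
  move=> hp j; pose v := dir R (j + 5).
  have v1 : outward j v = 1.
    by have [_ + _ _] := outward_dir R (j + 5); rewrite -addnS outward_periodic.
  have [t t0 /(_ j)] := interior_ray v hp.
  by rewrite outwardD outwardZ v1; lra.
move=> hp; rewrite /interior /=.
have : \forall q \near p, forall i : 'I_6, outward i q < h i.
  apply: (@filter_forall _ _ (fun (i : 'I_6) q => outward i q < h i) (nbhs p)) => i.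
  have /= o := @open_lt R^o (h i).
  apply: (@outward_continuous i p [set x : R^o | x < h i]).
  exact: (@open_nbhs_nbhs R^o _ _ (conj o (hp i))).
apply: filterS => q hq j.
by rewrite (periodic_mod per) (periodic_mod (@outward_periodic R ^~ q)) ltW //;
  exact: (hq (Ordinal (ltn_pmod j (isT : 0 < 6)%N))).
Qed.

Lemma hexagon_boundary h : (forall j, h (j + 6)%N = h j) ->
  boundary (hexagon h) = [set p | hexagon h p /\ exists j, outward j p = h j].
Proof.
move=> per; rewrite /boundary -(closure_id _).1; last exact: hexagon_closed.
rewrite hexagon_interior //; apply/seteqP; split=> p [hp np]; split=> //.
  apply: contrapT => nj; apply: np => j; rewrite lt_neqAle hp andbT.
  by apply/eqP => e; apply: nj; exists j.
by case: np => j e /(_ j); rewrite e ltxx.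
Qed.

(** Modulo 6, [j + 5] is [j - 1]: the side on the line [outward j = h j] runs from vertex [j - 1] to
    vertex [j], which matches the indexing of the moves of the walk. *)
Lemma hexagon_boundary_bigcup h : tight h ->
  boundary (hexagon h) = \bigcup_(j in [set: 'I_6])
    segment (vertex h (j + 5)) (vertex h (j.+1 + 5)).
Proof.
move=> supp; have [per _] := supp; rewrite hexagon_boundary //.
have U5 j p : outward (j + 5).+1 p = outward j p by rewrite -addnS outward_periodic.
have h5 j : h (j + 5).+1 = h j by rewrite -addnS per.
apply/seteqP; split=> p.
  move=> [hp [j e]].
  have j6 : (j %% 6 < 6)%N by rewrite ltn_mod.
  exists (Ordinal j6) => //=; rewrite -face_segment //; split=> //=.
  rewrite U5 h5 -(periodic_mod per).
  by rewrite -(periodic_mod (@outward_periodic R ^~ p)).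
move=> [j _]; rewrite -face_segment // => -[hp /=]; rewrite U5 h5 => e.
by split=> //; exists j.
Qed.

End Tiling.

(** * The boundary walk and the character *)

Section Character.
Variable R : realType.
Implicit Types (p q : plane R) (j : nat) (h : nat -> R) (a : 6.-tuple nat).

Lemma horizontal_lineE (k : int) :
  @horizontal_line R k = [set p | outward 0 p = - k%:~R].
Proof.
have h0 := height_neq0 R; apply/seteqP.
split=> p; rewrite /horizontal_line /outward /=; first by move=> ->; rewrite mulfK.
by move=> /oppr_inj <-; rewrite divfK.
Qed.

Lemma outward6 p : outward 6 p = outward 0 p.
Proof. exact: (outward_periodic 0). Qed.

(** The lowest side lies on [outward 0 = h 0] and is run leftwards from the vertex of index [-1],
    written 5. *)
Lemma start_pointP h p : tight h -> h 0%N \is a Num.int ->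
  start_point (hexagon h) p <-> p = vertex h 5.
Proof.
move=> supp h0int; have [per _] := supp; have h6 : h 6%N = h 0%N := per 0%N.
have v5 := vertex_hexagon 5 supp.
have u5 : outward 0 (vertex h 5) = h 0%N by rewrite -outward6 outwardS_vertex.
have le0 := edge_ge0 5 supp.
have h0K : (Num.floor (- h 0%N))%:~R = - h 0%N by rewrite floorK ?rpredN.
have dir6 : dir R 6 = (-1, 0) by rewrite -[6%N]/(0 + 6)%N dir_periodic dir0.
have bottom q : hexagon h q -> outward 0 q = h 0%N ->
    exists2 t, 0 <= t & q = vertex h 5 + t *: dir R 6.
  move=> hq eq0; have : (hexagon h `&` [set p | outward 6 p = h 6%N]) q.
    by split=> //=; rewrite outward6 h6.
  rewrite face_segment // => -[t /= /andP[t0 _]]; rewrite vertexSB scalerA => <-.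
  by exists (t * edge h 5) => //; rewrite mulr_ge0.
split.
  move=> [k [mink []]]; rewrite horizontal_lineE => hp /= pk maxp.
  have lek : k%:~R <= - h 0%N.
    rewrite -h0K ler_int; apply: mink; exists (vertex h 5); split=> //.
    by rewrite horizontal_lineE /= h0K u5 opprK.
  have pE : outward 0 p = h 0%N by have := hp 0%N; lra.
  have := maxp (vertex h 5); rewrite /= u5 => /(_ _)/wrap[].
    by split=> //=; lra.
  have [t t0 ->] := bottom p hp pE; rewrite dir6 /= /GRing.scale /=.
  move=> ?; have -> : t = 0 by lra.
  by apply: plane_eq; rewrite /= /GRing.scale /=; ring.
move=> ->; exists (Num.floor (- h 0%N)); rewrite !horizontal_lineE h0K opprK; split.
- move=> j [q []]; rewrite horizontal_lineE => hq /= qj.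
  by rewrite -(@ler_int R) h0K; have := hq 0%N; lra.
- by split.
- move=> q [hq /= qE]; have [t t0 ->] := bottom q hq qE.
  by rewrite dir6 /= /GRing.scale /=; lra.
Qed.

Lemma walk0 p a : walk p a 0 = p.
Proof. by rewrite /walk big_ord0 addr0. Qed.

Lemma walkS p a m : walk p a m.+1 = walk p a m + (entry a m.+1)%:R *: dir R m.
Proof. by rewrite /walk big_ord_recr addrA. Qed.

Lemma walk_vertex h a m : tight h ->
  (forall j, (j < m)%N -> (entry a j.+1)%:R = edge h (j + 5)) ->
  walk (vertex h 5) a m = vertex h (m + 5).
Proof.
move=> supp; elim: m => [|m IH] hm; first by rewrite walk0.
rewrite walkS IH => [|j jm]; last by apply: hm; rewrite ltnW.
by rewrite hm // addSn vertexS -addnS dir_periodic.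
Qed.

Lemma outward_walk j p a m : outward j (walk p a m) =
  outward j p + \sum_(i < m) (entry a i.+1)%:R * outward j (dir R i).
Proof.
elim: m => [|m IH]; first by rewrite walk0 big_ord0 addr0.
by rewrite walkS outwardD outwardZ IH big_ord_recr addrA.
Qed.

(** With indices modulo 6, [outward j] grows on the moves along [dir (j - 2)] and [dir (j - 1)], is
    constant along [dir j], decreases along [dir (j + 1)] and [dir (j + 2)], and is constant along
    [dir (j + 3)]. On a closed walk its maximum is therefore reached after [j] moves. *)
Lemma walk_max p a i j : walk p a 6 = p -> (i <= 6)%N -> (j < 6)%N ->
  outward j (walk p a i) <= outward j (walk p a j).
Proof.
move=> closed; have [c00 c10 c01 c11] := outward_dir R 0.
have e0 : outward 0 (walk p a 6) = outward 0 p by rewrite closed.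
have e1 : outward 1 (walk p a 6) = outward 1 p by rewrite closed.
rewrite !outward_walk lerD2l.
move: e0 e1; rewrite !outward_walk !big_ord_recr !big_ord0 /=.
have b0 k : 0 <= (entry a k)%:R :> R by rewrite ler0n.
have := b0 1%N; have := b0 2%N; have := b0 3%N; have := b0 4%N.
have := b0 5%N; have := b0 6%N.
rewrite !dirSS !outwardB c00 c10 c01 c11 => ? ? ? ? ? ? e0 e1.
move: i j => [|[|[|[|[|[|[|//]]]]]]] [|[|[|[|[|[|//]]]]]] _ _;
  rewrite ?big_ord_recr ?big_ord0 /= ?dirSS ?outwardB ?outwardSS ?c00 ?c10 ?c01 ?c11;
  lra.
Qed.

Lemma convex_le (c x y t : R) : 0 <= t <= 1 -> x <= c -> y <= c ->
  x + t * (y - x) <= c.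
Proof.
move=> /andP[t0 t1] xc yc.
have : 0 <= (1 - t) * (c - x) by rewrite mulr_ge0 // subr_ge0.
have : 0 <= t * (c - y) by rewrite mulr_ge0 // subr_ge0.
by nra.
Qed.

(** This yields uniqueness of the character: the points of any admissible walk are forced to be the
    vertices. *)
Lemma traverses_boundary_edge h a : tight h -> h 0%N \is a Num.int ->
  traverses_boundary (hexagon h) a ->
  forall j, (j < 6)%N -> (entry a j.+1)%:R = edge h (j + 5).
Proof.
move=> supp h0int [p [/(start_pointP _ supp h0int) -> closed bE]].
have [per _] := supp; set W := walk (vertex h 5) a.
have Wbd j : (j < 6)%N -> boundary (hexagon h) (W j).
  move=> j6; rewrite bE; exists (Ordinal j6) => //.
  by exists 0; rewrite /= ?lexx ?ler01 // scale0r addr0.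
(* [vertex h j] lies on some segment of the walk, and there [outward j] is at most its value at
   [W j]. *)
have UW j : (j < 6)%N -> outward j (W j) = h j.
  move=> j6; apply/le_anti/andP; split.
    by have := Wbd j j6; rewrite hexagon_boundary // => -[].
  have : boundary (hexagon h) (vertex h j).
    rewrite hexagon_boundary //; split; first exact: vertex_hexagon.
    by exists j; rewrite outward_vertex.
  rewrite bE => -[i _ [t /= t01 /(congr1 (outward j))]].
  rewrite outward_vertex outwardD outwardZ outwardB => <-.
  by apply: convex_le => //; apply: walk_max; rewrite ?(ltnW (ltn_ord i)) ?ltn_ord.
have UWS j : (j < 6)%N -> outward j (W j.+1) = h j.
  move=> j6; rewrite /W walkS outwardD outwardZ UW //.
  by have [-> _ _ _] := outward_dir R j; rewrite mulr0 addr0.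
(* Indices 0 and 6 are the start and the closing of the walk; in between, [W m.+1] is determined by
   its values under [outward m] and [outward m.+1]. *)
have WE m : (m <= 6)%N -> W m = vertex h (m + 5).
  case: m => [|m] m6; first by rewrite /W walk0.
  move: m6; rewrite leq_eqVlt => /predU1P[[->]|m5].
    by rewrite /W closed; exact: (esym (vertex_periodic 5 supp)).
  rewrite addSn -addnS vertex_periodic //; apply: (@outward_inj _ m).
    by rewrite UWS ?outward_vertex // ltnW.
  by rewrite UW // outwardS_vertex.
move=> j j6; have : W j.+1 - W j = (entry a j.+1)%:R *: dir R j.
  by rewrite {1}/W walkS [LHS]addrC addKr.
rewrite !WE // 1?ltnW // addSn vertexSB -addnS dir_periodic.
move/(congr1 (outward j.+1)); rewrite !outwardZ.
by have [_ -> _ _] := outward_dir R j; rewrite !mulr1 => ->.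
Qed.

Lemma traverses_boundary_ex h : tight h -> (forall j, h j \is a Num.int) ->
  exists a, traverses_boundary (hexagon h) a.
Proof.
move=> supp hint; pose a := [tuple of mkseq (fun j => Num.truncn (edge h (j + 5))) 6].
have aE j : (j < 6)%N -> (entry a j.+1)%:R = edge h (j + 5).
  move=> j6; rewrite /entry /a /= (nth_mkseq _ _ j6) truncnK // natrEint.
  by rewrite edge_ge0 // andbT rpredB ?rpredD.
have wE m : (m <= 6)%N -> walk (vertex h 5) a m = vertex h (m + 5).
  by move=> m6; apply: walk_vertex => // j jm; rewrite aE // (leq_trans jm).
exists a, (vertex h 5); split; first exact/start_pointP.
  by rewrite wE //; exact: (vertex_periodic 5 supp).
rewrite hexagon_boundary_bigcup //; apply: eq_bigcupr => j _.
by rewrite !wE // ltnW.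
Qed.

Lemma character_edge h : tight h -> (forall j, h j \is a Num.int) ->
  forall j, (j < 6)%N -> (entry (character (hexagon h)) j.+1)%:R = edge h (j + 5).
Proof.
move=> supp hint; apply: (traverses_boundary_edge supp (hint 0%N)).
exact: (xgetPex _ (traverses_boundary_ex supp hint)).
Qed.

End Character.

(** * Sides and perimeter *)

Section Perimeter.
Variable R : realType.
Implicit Types (p q : plane R) (j : nat) (h : nat -> R).

Lemma dist_scale (v : plane R) p (s t : R) :
  dist (p + s *: v) (p + t *: v) = `|s - t| * dist v 0.
Proof.
rewrite /dist /= /GRing.scale /= -sqrtr_sqr -sqrtrM ?sqr_ge0 //.
by congr Num.sqrt; ring.
Qed.

Lemma dist_sub p q : dist p q = dist (p - q) 0.
Proof. by rewrite /dist /=; congr Num.sqrt; ring. Qed.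

Lemma dist_sym p q : dist p q = dist q p.
Proof. by rewrite /dist; congr Num.sqrt; ring. Qed.

Lemma dist_dir j (t : R) : dist (t *: dir R j) 0 = `|t|.
Proof.
rewrite (distE j) subr0 !outwardZ; have [-> -> _ _] := outward_dir R j.
by rewrite -sqrtr_sqr; congr Num.sqrt; ring.
Qed.

Lemma diameter_segment p q : diameter (segment p q) = dist p q.
Proof.
rewrite /diameter; set D := [set _ | _ in _].
have dE : dist p q = dist (q - p) 0 by rewrite dist_sym dist_sub.
have ubD : ubound D (dist p q).
  move=> _ [[x y] [[s /= /andP[s0 s1] <-] [t /= /andP[t0 t1] <-]] <-] /=.
  rewrite dist_scale dE ler_piMl ?sqrtr_ge0 // ler_norml; apply/andP; split; lra.
have memD : D (dist p q).
  exists (p, q) => //; split; [exists 0 | exists 1];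
    rewrite /= ?lexx ?ler01 ?scale0r ?addr0 //.
  by rewrite scale1r addrC subrK.
apply/le_anti/andP; split; first by apply: ge_sup => //; exists (dist p q).
by apply: ub_le_sup => //; exists (dist p q).
Qed.

Definition face h j : set (plane R) := segment (vertex h j) (vertex h j.+1).

Lemma diameter_face h j : tight h -> diameter (face h j) = edge h j.
Proof.
move=> supp; rewrite diameter_segment dist_sym dist_sub vertexSB dist_dir.
by rewrite ger0_norm // edge_ge0.
Qed.

Lemma faceE h j : tight h ->
  face h j = hexagon h `&` [set p | outward j.+1 p = h j.+1].
Proof. by move=> supp; rewrite face_segment. Qed.

Lemma vertex_face h j : tight h -> face h j (vertex h j).
Proof.
move=> supp; rewrite faceE //; split; first exact: vertex_hexagon.
exact: outwardS_vertex.
Qed.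

Lemma vertexS_face h j : tight h -> face h j (vertex h j.+1).
Proof.
move=> supp; rewrite faceE //; split; first exact: vertex_hexagon.
exact: outward_vertex.
Qed.

Lemma outward_opp3 j p : outward j.+3 p = - outward j p.
Proof. by rewrite -addn3 outward_opp. Qed.

Lemma hexagon_interior_neq0 h : tight h ->
  (forall j, 0 < h j + h j.+3) -> interior (hexagon h) !=set0.
Proof.
move=> supp w; have [per _] := supp; rewrite hexagon_interior //.
(* The barycentre of alternate vertices: for each constraint one of the three lies on the opposite
   line, hence satisfies it strictly. *)
exists (3^-1 *: (vertex h 0 + vertex h 2 + vertex h 4)).
have bary i : outward i (vertex h 0) < h i \/ outward i (vertex h 2) < h i \/
    outward i (vertex h 4) < h i ->
    outward i (3^-1 *: (vertex h 0 + vertex h 2 + vertex h 4)) < h i.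
  have a0 := vertex_hexagon 0 supp i; have a2 := vertex_hexagon 2 supp i.
  have a4 := vertex_hexagon 4 supp i.
  by rewrite outwardZ 2!outwardD; case=> [|[]] ?; lra.
have opp j k : outward j.+3 (vertex h k) = h j.+3 -> outward j (vertex h k) < h j.
  by rewrite outward_opp3; have := w j; lra.
apply: (@periodic6_ind _ _ 0%N) => [i||||||].
- by rewrite outward_periodic per.
- by apply: bary; right; left; apply: opp; rewrite outwardS_vertex.
- by apply: bary; right; right; apply: opp; rewrite outward_vertex.
- by apply: bary; right; right; apply: opp; rewrite outwardS_vertex.
- apply: bary; left; apply: opp.
  rewrite -[6%N]/(0 + 6)%N outward_periodic per; exact: outward_vertex.
- apply: bary; left; apply: opp.
  rewrite -[7%N]/(1 + 6)%N outward_periodic per; exact: outwardS_vertex.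
- apply: bary; right; left; apply: opp.
  rewrite -[8%N]/(2 + 6)%N outward_periodic per; exact: outward_vertex.
Qed.

(** Edges [i + 1] and [i + 2] add up to the vanishing width, as do edges [i + 4] and [i + 5]; being
    nonnegative, all four are 0, and edges [i] and [i + 3] are equal. *)
Lemma sum_edge_degenerate h i : tight h -> (i < 3)%N -> h i.+1 + h i.+4 = 0 ->
  \sum_(j < 6) edge h j = 2 * edge h i.
Proof.
move=> [per subl] i3; rewrite !big_ord_recr big_ord0 /= /edge.
have h6 : h 6%N = h 0%N := per 0%N; have h7 : h 7%N = h 1%N := per 1%N.
have := subl 0%N; have := subl 1%N; have := subl 2%N; have := subl 3%N.
have := subl 4%N; have := subl 5%N; rewrite h6 h7.
by move: i i3 => [|[|[|//]]] _; lra.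
Qed.

Lemma hexagon_degenerate h i : tight h -> h i.+1 + h i.+4 = 0 ->
  hexagon h = face h i.
Proof.
move=> supp w0; rewrite faceE //; apply/seteqP; split=> [p hp|p []//].
split=> //=; have := hp i.+1; have := hp i.+4; rewrite outward_opp3; lra.
Qed.

Definition dot (u p : plane R) : R := u.1 * p.1 + u.2 * p.2.

Lemma dotD u p q : dot u (p + q) = dot u p + dot u q.
Proof. by rewrite /dot /=; ring. Qed.

Lemma dotZ u (t : R) p : dot u (t *: p) = t * dot u p.
Proof. by rewrite /dot /= /GRing.scale /=; ring. Qed.

Lemma dotB u p q : dot u (p - q) = dot u p - dot u q.
Proof. by rewrite /dot /=; ring. Qed.

Lemma dot_gt0 u : u != 0 -> 0 < dot u u.
Proof.
move=> u0; rewrite lt_def /dot -!expr2 addr_ge0 ?sqr_ge0 // andbT.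
rewrite paddr_eq0 ?sqr_ge0 // !sqrf_eq0.
by apply: contraNN u0 => /andP[/eqP ? /eqP ?]; apply/eqP/plane_eq.
Qed.

Definition normal j : plane R := (outward j (1, 0), outward j (0, 1)).

Lemma outward_dot j p : outward j p = dot (normal j) p.
Proof.
have {1}-> : p = p.1 *: (1, 0) + p.2 *: (0, 1).
  by apply: plane_eq; rewrite /= /GRing.scale /=; ring.
by rewrite outwardD !outwardZ /dot /=; ring.
Qed.

Lemma dotK u i p :
  dot u p = outward i.+1 p * dot u (dir R i) - outward i p * dot u (dir R i.+1).
Proof. by rewrite {1}(outwardK i p) dotB !dotZ. Qed.

Lemma outward_dirS j k : outward j.+1 (dir R k.+1) = outward j (dir R k).
Proof.
have [a0 a1 a2 a3] := outward_dir R 0; have [b0 b1 b2 b3] := outward_dir R 1.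
by move: j; apply: hexrec_ext => [j|j||]; rewrite ?outwardSS //; move: k;
  apply: hexrec_ext => [k|k||]; rewrite ?dirSS ?outwardB //; lra.
Qed.

Lemma outward_dir_neq0 i k : (i < 6)%N -> (k < 6)%N ->
  outward k (dir R i) = 0 -> k = i \/ (k = i + 3 \/ i = k + 3)%N.
Proof.
move=> i6 k6; have [c00 c10 c01 c11] := outward_dir R 0.
move: i k i6 k6 => [|[|[|[|[|[|//]]]]]] [|[|[|[|[|[|//]]]]]] _ _;
  rewrite ?dirSS ?outwardB ?outwardSS ?c00 ?c10 ?c01 ?c11;
  by [left | right; left | right; right | move=> ?; exfalso; lra].
Qed.

(** Coinciding faces of positive length lie on parallel lines, so their indices are equal or
    opposite; positive widths keep opposite lines apart. *)
Lemma face_inj h : tight h -> (forall j, 0 < h j + h j.+3) ->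
  set_inj [set i : 'I_6 | 0 < edge h i] (fun i : 'I_6 => face h i).
Proof.
move=> supp w i k; rewrite !inE /= => ei ek E; apply: val_inj => /=.
have := vertexS_face i supp; rewrite E faceE // => -[_ /= e1].
have := vertex_face i supp; rewrite E faceE // => -[_ /= e0].
have [per _] := supp.
have z : outward k.+1 (dir R i.+1) = 0.
  have := congr1 (outward k.+1) (vertexSB h i).
  rewrite outwardB e0 e1 subrr outwardZ => /esym/eqP.
  by rewrite mulf_eq0 gt_eqF //= => /eqP.
have z' : outward k (dir R i) = 0.
  by rewrite -outward_dirS.
have := outward_dir_neq0 (ltn_ord i) (ltn_ord k) z'.
have ui := outwardS_vertex h i.
case=> [//|[] e]; exfalso.
  move: e0; rewrite e addn3 outward_opp3 ui => e0.
  by have := w i.+1; rewrite -e0; lra.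
have := outward_opp3 k.+1 (vertex h i); rewrite -[k.+4]addn3 addSn -e e0 ui e => e2.
by have := w k.+1; rewrite addn3 in e2; rewrite e2; lra.
Qed.

Lemma sides_hexagon h : tight h -> (forall j, 0 < h j + h j.+3) ->
  [set S | side (hexagon h) S] =
  (fun i : 'I_6 => face h i) @` [set i : 'I_6 | 0 < edge h i].
Proof.
move=> supp w; have [per _] := supp; apply/seteqP; split=> S.
  move=> [u [c [u0 umax SE [p [q [Sp Sq pq]]]]]].
  move: Sp Sq; rewrite SE => -[hp /= up] [hq /= uq].
  (* If the midpoint [m] were interior, a move along [u] would exceed the maximum [c]. So some
     constraint is an equality at [m], hence at [p] and at [q]. *)
  pose m := 2^-1 *: (p + q).
  have um : dot u m = c by rewrite dotZ dotD /dot up uq; lra.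
  have [i im] : exists i : 'I_6, outward i.+1 m >= h i.+1.
    apply: contrapT => nm; have : interior (hexagon h) m.
      rewrite hexagon_interior //=.
      have mi (i : 'I_6) : outward i.+1 m < h i.+1.
        by rewrite ltNge; apply/negP => ?; apply: nm; exists i.
      apply: (@periodic6_ind _ _ 1%N) => [i||||||].
      + by rewrite outward_periodic per.
      + exact: (mi (@Ordinal 6 0 isT)).
      + exact: (mi (@Ordinal 6 1 isT)).
      + exact: (mi (@Ordinal 6 2 isT)).
      + exact: (mi (@Ordinal 6 3 isT)).
      + exact: (mi (@Ordinal 6 4 isT)).
      + exact: (mi (@Ordinal 6 5 isT)).
    move=> /(interior_ray u)[t t0 /umax]; rewrite -/(dot u _) dotD um dotZ.
    by have := mulr_gt0 t0 (dot_gt0 u0); lra.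
  have {im}[ip iq] : outward i.+1 p = h i.+1 /\ outward i.+1 q = h i.+1.
    by move: im; rewrite outwardZ outwardD; have := hp i.+1; have := hq i.+1; lra.
  have [d0 d1 d2 d3] := outward_dir R i.+1.
  (* [q - p] is a nonzero multiple of [dir R i.+1] and orthogonal to [u], so [dot u] is a multiple
     of [outward i.+1]. *)
  have ud : dot u (dir R i.+1) = 0.
    have : dot u (q - p) = 0 by rewrite dotB /dot uq up subrr.
    have e0 : outward i.+1 (q - p) = 0 by rewrite outwardB ip iq subrr.
    rewrite (dotK u i.+1) e0 mul0r subr0.
    move=> /eqP; rewrite mulf_eq0 => /orP[/eqP z|/eqP //]; exfalso.
    move/eqP: pq; apply; apply: (@outward_inj _ i.+1); first by rewrite ip iq.
    by apply/esym/eqP; rewrite -subr_eq0 -outwardB z.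
  have uE x : dot u x = dot u (dir R i) * outward i.+1 x.
    by rewrite (dotK u i) ud; ring.
  set l := dot u (dir R i) in uE.
  have l0 : l != 0 by apply/eqP => l0; have := dot_gt0 u0; rewrite uE l0; lra.
  have cE : c = l * h i.+1 by rewrite -ip -uE -up.
  (* [vertex h i.+3] lies on the opposite line, where a negative [l] would violate [umax]. *)
  have l_gt0 : 0 < l.
    rewrite lt_def l0 /=.
    have := umax _ (vertex_hexagon i.+3 supp); rewrite -/(dot _ _) uE cE.
    have e := outward_opp3 i.+1 (vertex h i.+3); rewrite outwardS_vertex in e.
    have -> : outward i.+1 (vertex h i.+3) = - h i.+4 by rewrite e opprK.
    by have := w i.+1; nra.
  have -> : hexagon h `&` [set x | u.1 * x.1 + u.2 * x.2 = c] = face h i.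
    rewrite faceE //; congr (_ `&` _); apply/seteqP; split=> x /=;
      rewrite -/(dot u x) uE cE; last by move=> ->.
    exact: mulfI.
  exists i => //=; rewrite lt_def edge_ge0 // andbT; apply/eqP => e0.
  move/eqP: pq; apply.
  have pt x : face h i x -> x = vertex h i.
    by move=> [t _ <-]; rewrite vertexSB e0 scale0r scaler0 addr0.
  have pE : p = vertex h i by apply: pt; rewrite faceE.
  have qE : q = vertex h i by apply: pt; rewrite faceE.
  by rewrite pE qE.
move=> [i /= ei <-]; have [d0 d1 d2 d3] := outward_dir R i.
exists (normal i.+1), (h i.+1); split.
- apply/eqP => n0; have := outward_dot i.+1 (dir R i); rewrite d1 n0 /dot /=.
  by rewrite !mul0r addr0; lra.
- by move=> p hp; rewrite -/(dot _ _) -outward_dot; exact: hp.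
- rewrite faceE //; congr (_ `&` _); apply/seteqP.
  by split=> p; have := outward_dot i.+1 p; rewrite /dot /= => ->.
- exists (vertex h i), (vertex h i.+1); split.
  + exact: vertex_face.
  + exact: vertexS_face.
  + apply/eqP => e; have := vertexSB h i; rewrite e subrr.
    have [_ d _ _] := outward_dir R i.+1.
    by move/(congr1 (outward i.+2)); rewrite outward0 outwardZ d; lra.
Qed.

(** With empty interior some width is 0 and the hexagon is a single face, counted twice. Otherwise
    the sides are the faces of positive length, and edges of length 0 add nothing to the sum. *)
Lemma perimeter_hexagon h : tight h ->
  perimeter (hexagon h) = \sum_(j < 6) edge h j.
Proof.
move=> supp; have [per _] := supp; rewrite /perimeter; case: asboolP => [int0|nint].
  have [i i3 wi] : exists2 i, (i < 3)%N & h i.+1 + h i.+4 = 0.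
    apply: contrapT => nw.
    have pos i : (i < 3)%N -> 0 < h i.+1 + h i.+4.
      move=> i3; rewrite lt_def width_ge0 // andbT; apply/eqP => wi.
      by apply: nw; exists i.
    have [] : interior (hexagon h) !=set0; last by rewrite int0.
    apply: hexagon_interior_neq0 => //.
    apply: (@periodic6_ind _ _ 1%N) => [i||||||].
    + by rewrite -!addSn !per.
    + exact: pos 0%N isT.
    + exact: pos 1%N isT.
    + exact: pos 2%N isT.
    + by rewrite -[7%N]/(1 + 6)%N per addrC; exact: pos 0%N isT.
    + by rewrite -[8%N]/(2 + 6)%N per addrC; exact: pos 1%N isT.
    + by rewrite -[9%N]/(3 + 6)%N per addrC; exact: pos 2%N isT.
  by rewrite (sum_edge_degenerate supp i3 wi) (hexagon_degenerate supp wi)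
             diameter_face.
have w j : 0 < h j + h j.+3.
  have /set0P[p] : interior (hexagon h) != set0 by apply/eqP.
  rewrite hexagon_interior // => hp; have := hp j; have := hp j.+3.
  by rewrite outward_opp3; lra.
rewrite sides_hexagon // fsbig_image; last exact: face_inj.
under eq_fsbigr => i _ do rewrite diameter_face //.
rewrite (fsbig_fwiden (index_enum 'I_6)) ?index_enum_uniq //.
  by move=> i _ /=; rewrite mem_index_enum.
move=> i [_ /= /negP]; rewrite -leNgt => ?; apply/le_anti.
by rewrite edge_ge0 // andbT.
Qed.

End Perimeter.

(** * Lattice vectors and isometries *)

Section Symmetries.
Variable R : realType.
Implicit Types (p q : plane R) (j : nat) (h : nat -> R).

Definition lattice_vector p := forall j, outward j p \is a Num.int.

Lemma lattice_vectorP p : outward 0 p \is a Num.int ->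
  outward 1 p \is a Num.int -> lattice_vector p.
Proof.
move=> p0 p1.
suff h j : outward j p \is a Num.int /\ outward j.+1 p \is a Num.int.
  by move=> j; case: (h j).
by elim: j => [//|j [? ?]]; split=> //; rewrite outwardSS rpredB.
Qed.

Lemma tiling_vertexP p : tiling_vertex p <-> lattice_vector p.
Proof.
split=> [vp|ip i]; last first.
  by exists (Num.floor (outward (3 - i) p)); rewrite tiling_lineE /= floorK.
have int3 (i : 'I_3) : outward (3 - i) p \is a Num.int.
  by have [k] := vp i; rewrite tiling_lineE => /= ->; exact: intr_int.
have i1 : outward 1 p \is a Num.int by have := int3 (inord 2); rewrite inordK.
have i2 : outward 2 p \is a Num.int by have := int3 (inord 1); rewrite inordK.
apply: lattice_vectorP => //.
have -> : outward 0 p = outward 1 p - outward 2 p by rewrite outwardSS; ring.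
by rewrite rpredB.
Qed.

Lemma isometry_dir (f : plane R -> plane R) : plane_isometry f -> forall p,
  f p = f 0 + outward 1 p *: (f (dir R 0) - f 0)
            - outward 0 p *: (f (dir R 1) - f 0).
Proof.
move=> iso p.
have sq q r : ((f q).1 - (f r).1) ^+ 2 + ((f q).2 - (f r).2) ^+ 2 =
    outward 0 (q - r) ^+ 2 - outward 0 (q - r) * outward 1 (q - r)
    + outward 1 (q - r) ^+ 2.
  rewrite -normE; have /(congr1 (@GRing.exp R ^~ 2)) := iso q r.
  by rewrite /dist !sqr_sqrtr // addr_ge0 ?sqr_ge0.
have [c00 c10 c01 c11] := outward_dir R 0.
have A := sq (dir R 0) 0; have B := sq (dir R 1) 0; have AB := sq (dir R 0) (dir R 1).
have F := sq p 0; have FA := sq p (dir R 0); have FB := sq p (dir R 1).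
move: A B AB F FA FB; rewrite !outwardB !outward0 c00 c10 c01 c11.
move: (outward 1 p) (- outward 0 p) (opprK (outward 0 p)) => x y <-.
rewrite scaleNr opprK.
move: (f p) (f 0) (f (dir R 0)) (f (dir R 1)) => [p1 p2] [z1 z2] [a1 a2] [b1 b2].
move=> /= A B AB F FA FB.
(* The squared length of the defect is a combination of squared distances between images under [f];
   these equal the original ones, for which the defect is 0. *)
have : (p1 - z1 - x * (a1 - z1) - y * (b1 - z1)) ^+ 2 +
       (p2 - z2 - x * (a2 - z2) - y * (b2 - z2)) ^+ 2 = 0.
  transitivity ((1 - x - y) * ((p1 - z1) ^+ 2 + (p2 - z2) ^+ 2)
    + (x ^+ 2 - x + x * y) * ((a1 - z1) ^+ 2 + (a2 - z2) ^+ 2)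
    + (y ^+ 2 - y + x * y) * ((b1 - z1) ^+ 2 + (b2 - z2) ^+ 2)
    + x * ((p1 - a1) ^+ 2 + (p2 - a2) ^+ 2)
    + y * ((p1 - b1) ^+ 2 + (p2 - b2) ^+ 2)
    - x * y * ((a1 - b1) ^+ 2 + (a2 - b2) ^+ 2)); first by ring.
  by rewrite A B AB F FA FB; ring.
move/eqP; rewrite paddr_eq0 ?sqr_ge0 // !sqrf_eq0 => /andP[/eqP e1 /eqP e2].
by apply: plane_eq; rewrite /= /GRing.scale /=; lra.
Qed.

Lemma unit_difference (s t : R) : -1 <= s <= 1 -> -1 <= t <= 1 ->
  -1 <= s + t <= 1 -> s ^+ 2 + s * t + t ^+ 2 = 1 ->
  [\/ s = 0 /\ `|t| = 1, t = 0 /\ `|s| = 1 | `|s| = 1 /\ s = - t].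
Proof.
have sqr_le1 (x : R) : -1 <= x <= 1 -> x ^+ 2 <= 1.
  by move=> /andP[? ?]; rewrite -subr_ge0 -[1](expr1n _ 2) subr_sqr mulr_ge0; lra.
have abs1 (x : R) : x ^+ 2 = 1 -> `|x| = 1.
  by move=> e; apply/eqP; rewrite -sqrp_eq1 ?normr_ge0 // real_normK ?num_real // e.
move=> /sqr_le1 s1 /sqr_le1 t1 /sqr_le1 st1 e.
(* By [e], [s t = (s + t)^2 - 1], [s (s + t) = 1 - t^2] and [t (s + t) = 1 - s^2], which fixes the
   signs. The product of the last two is [s t (s + t)^2], so it is 0. *)
have p1 : s * t <= 0 by move: st1; rewrite sqrrD; lra.
have p2 : 0 <= s * (s + t) by lra.
have p3 : 0 <= t * (s + t) by lra.
have : (s * (s + t)) * (t * (s + t)) = 0.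
  apply/le_anti; rewrite (mulr_ge0 p2 p3) andbT.
  have -> : (s * (s + t)) * (t * (s + t)) = (s * t) * (s + t) ^+ 2 by ring.
  by rewrite mulr_le0_ge0 ?sqr_ge0.
move/eqP; rewrite !mulf_eq0 => /orP[|] /orP[] /eqP z.
- by constructor 1; split=> //; apply: abs1; rewrite z in e; lra.
- constructor 3; split; last lra.
  apply: abs1; have tE : t = - s by lra.
  by rewrite tE in e; lra.
- by constructor 2; split=> //; apply: abs1; rewrite z in e; lra.
- constructor 3; split; last lra.
  apply: abs1; have tE : t = - s by lra.
  by rewrite tE in e; lra.
Qed.

Lemma dist_sqr p q : dist p q = 1 -> (p.1 - q.1) ^+ 2 + (p.2 - q.2) ^+ 2 = 1.
Proof.
move=> /(congr1 (@GRing.exp R ^~ 2)); rewrite /dist sqr_sqrtr ?expr1n //.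
by rewrite addr_ge0 ?sqr_ge0.
Qed.

Lemma unit_outward p : dist p 0 = 1 ->
  outward 0 p ^+ 2 - outward 0 p * outward 1 p + outward 1 p ^+ 2 = 1.
Proof. by move=> /dist_sqr <-; rewrite -normE !subr0. Qed.

Lemma lattice_vectorN p : lattice_vector p -> lattice_vector (- p).
Proof. by move=> lp j; rewrite outwardN rpredN. Qed.

Lemma lattice_vectorB p q :
  lattice_vector p -> lattice_vector q -> lattice_vector (p - q).
Proof. by move=> lp lq j; rewrite outwardB rpredB. Qed.

(** Points of a unit triangle at distance 1 differ by a side vector up to sign. This avoids showing
    that symmetries send vertices of tiles to vertices. *)
Lemma unit_triangle_difference p q r x y : dist p q = 1 -> dist q r = 1 ->
  dist r p = 1 -> triangle p q r x -> triangle p q r y -> dist x y = 1 ->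
  lattice_vector (q - p) -> lattice_vector (r - p) -> lattice_vector (x - y).
Proof.
move=> /dist_sqr pq /dist_sqr qr /dist_sqr rp.
move=> [s [t [s0 t0 st ->]]] [s' [t' [s0' t0' st' ->]]] /dist_sqr xy lq lr.
set S := s - s'; set T := t - t'.
have xyE : p + s *: (q - p) + t *: (r - p) - (p + s' *: (q - p) + t' *: (r - p)) =
           S *: (q - p) + T *: (r - p).
  by apply: plane_eq; rewrite /= /GRing.scale /S /T /=; ring.
have N : S ^+ 2 + S * T + T ^+ 2 = 1.
  rewrite -xy; transitivity (S * (S + T) * ((p.1 - q.1) ^+ 2 + (p.2 - q.2) ^+ 2)
    + T * (S + T) * ((r.1 - p.1) ^+ 2 + (r.2 - p.2) ^+ 2)
    - S * T * ((q.1 - r.1) ^+ 2 + (q.2 - r.2) ^+ 2)).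
    by rewrite pq qr rp; ring.
  by rewrite /= /GRing.scale /S /T /=; ring.
rewrite xyE => j; rewrite outwardD !outwardZ.
have norm1 (u : R) : `|u| = 1 -> u = 1 \/ u = -1.
  by move/eqP; rewrite eqr_norml ler01 andbT => /orP[] /eqP; [left | right].
have bounds : [/\ -1 <= S <= 1, -1 <= T <= 1 & -1 <= S + T <= 1].
  by split; apply/andP; split; rewrite /S /T; lra.
have [bS bT bST] := bounds.
have int1 (u : R) : `|u| = 1 -> u \is a Num.int.
  by case/norm1 => ->; rewrite ?rpredN; exact: int_num1.
have [iS iT] : S \is a Num.int /\ T \is a Num.int.
  case: (unit_difference bS bT bST N) => -[].
  - by move=> -> /int1 iT; split=> //; exact: int_num0.
  - by move=> -> /int1 iS; split=> //; exact: int_num0.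
  - by move=> /int1 iS e; split=> //; rewrite -[T]opprK -e rpredN.
by rewrite rpredD ?rpredM ?lr ?lq.
Qed.

Lemma unit_lattice_vector p : lattice_vector p -> dist p 0 = 1 ->
  exists2 k, (k < 6)%N & p = dir R k.
Proof.
move=> lp /unit_outward.
have [c00 c10 c01 c11] := outward_dir R 0.
have /intrP[m em] := lp 0%N; have /intrP[l el] := lp 1%N; rewrite em el.
rewrite -!(rmorphXn (intmul 1)) -rmorphM -rmorphB -rmorphD => /eqP.
rewrite -[1]/(1%:~R) eqr_int => /eqP N.
have pE k : outward 0 (dir R k) = m%:~R -> outward 1 (dir R k) = l%:~R -> p = dir R k.
  by move=> e0 e1; apply: (@outward_inj _ 0); rewrite ?em ?el.
have [m1 m2] : (-1 <= m)%R /\ (m <= 1)%R by nia.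
have [l1 l2] : (-1 <= l)%R /\ (l <= 1)%R by nia.
have cases : [\/ m = 0 /\ l = 1, m = -1 /\ l = 0, m = -1 /\ l = -1 |
  [\/ m = 0 /\ l = -1, m = 1 /\ l = 0 | m = 1 /\ l = 1]].
  have : (m = -1 \/ m = 0 \/ m = 1)%R by lia.
  have : (l = -1 \/ l = 0 \/ l = 1)%R by lia.
  case=> [lE|[lE|lE]]; case=> [mE|[mE|mE]]; rewrite mE lE in N *;
  try (exfalso; lia); try (by constructor 1); try (by constructor 2);
  try (by constructor 3);
  constructor 4; try (by constructor 1); try (by constructor 2); by constructor 3.
case: cases => [[mE lE]|[mE lE]|[mE lE]|[[mE lE]|[mE lE]|[mE lE]]];
  [exists 0%N | exists 1%N | exists 2%N | exists 3%N | exists 4%N | exists 5%N] => //;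
  apply: pE; rewrite ?mE ?lE ?dirSS ?outwardB ?c00 ?c10 ?c01 ?c11; by lra.
Qed.

Lemma unit_dirs k m : (k < 6)%N -> (m < 6)%N -> dist (dir R k) (dir R m) = 1 ->
  m = ((k + 1) %% 6)%N \/ m = ((k + 5) %% 6)%N.
Proof.
move=> k6 m6; rewrite dist_sub => /unit_outward.
have [c00 c10 c01 c11] := outward_dir R 0.
move: k m k6 m6 => [|[|[|[|[|[|//]]]]]] [|[|[|[|[|[|//]]]]]] _ _;
  rewrite ?dirSS !outwardB ?c00 ?c10 ?c01 ?c11;
  by [left | right | move=> ?; exfalso; lra].
Qed.

End Symmetries.

(** * Action of the tiling symmetries on the edges; translations *)

Section Invariance.
Variable R : realType.
Implicit Types (p q : plane R) (j : nat) (h : nat -> R).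

Lemma lattice_vector_dir k : lattice_vector (dir R k).
Proof.
have [c00 c10 c01 c11] := outward_dir R 0.
suff [] : lattice_vector (dir R k) /\ lattice_vector (dir R k.+1) by [].
elim: k => [|k [IH0 IH1]].
  by split; apply: lattice_vectorP; rewrite ?(c00, c10, c01, c11) ?rpredN;
    rewrite ?int_num0 ?int_num1.
by split=> //; rewrite dirSS; exact: lattice_vectorB.
Qed.

Lemma dist_dir0 k : dist (dir R k) 0 = 1.
Proof. by rewrite -[dir R k]scale1r dist_dir normr1. Qed.

Lemma dist_dirS k : dist (dir R k) (dir R k.+1) = 1.
Proof. by rewrite dist_sym dist_sub -dirSS dist_dir0. Qed.

(** The rotation taking [dir 0], [dir 1] to [dir k], [dir (k + 1)] pulls index [j] back to [j - k].
    The factor 1 gives the shape [s + e * j] shared with reflections. *)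
Lemma rotation_outward_dir k j p : (k < 6)%N ->
  outward 1 p * outward j (dir R k) - outward 0 p * outward j (dir R ((k + 1) %% 6)) =
  outward ((6 - k) %% 6 + 1 * j) p.
Proof.
have [c00 c10 c01 c11] := outward_dir R 0; move=> k6; move: j.
apply: hexrec_ext => [j|j||].
- by rewrite !outwardSS; ring.
- by rewrite !mul1n !addnS outwardSS.
- by move: k k6 => [|[|[|[|[|[|//]]]]]] _;
    rewrite /= ?modnS ?outwardSS ?dirSS ?outwardB ?c00 ?c10 ?c01 ?c11; ring.
- by move: k k6 => [|[|[|[|[|[|//]]]]]] _;
    rewrite /= ?modnS ?outwardSS ?dirSS ?outwardB ?c00 ?c10 ?c01 ?c11; ring.
Qed.

(** The reflection taking [dir 0], [dir 1] to [dir k], [dir (k - 1)] pulls index [j] back to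
    [3 + k - j]; 5 stands for [-1]. *)
Lemma reflection_outward_dir k j p : (k < 6)%N ->
  outward 1 p * outward j (dir R k) - outward 0 p * outward j (dir R ((k + 5) %% 6)) =
  outward ((3 + k) %% 6 + 5 * j) p.
Proof.
have [c00 c10 c01 c11] := outward_dir R 0; move=> k6; move: j.
apply: hexrec_ext => [j|j||].
- by rewrite !outwardSS; ring.
- have -> : ((3 + k) %% 6 + 5 * j.+2 = ((3 + k) %% 6 + 5 * j).+1.+3.+3.+3)%N by lia.
  have -> : ((3 + k) %% 6 + 5 * j.+1 = ((3 + k) %% 6 + 5 * j).+2.+3)%N by lia.
  by rewrite !outward_opp3 outwardSS; ring.
- by move: k k6 => [|[|[|[|[|[|//]]]]]] _;
    rewrite /= ?modnS ?outwardSS ?dirSS ?outwardB ?c00 ?c10 ?c01 ?c11; ring.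
- by move: k k6 => [|[|[|[|[|[|//]]]]]] _;
    rewrite /= ?modnS ?outwardSS ?dirSS ?outwardB ?c00 ?c10 ?c01 ?c11; ring.
Qed.

Lemma symmetry_outward (f : plane R -> plane R) : tiling_symmetry f ->
  exists s e, [/\ (s < 6)%N, e = 1%N \/ e = 5%N &
    forall j p, outward j (f p) = outward j (f 0) + outward (s + e * j) p].
Proof.
move=> [iso im].
have lat0 : lattice_vector (0 : plane R) by move=> j; rewrite outward0 int_num0.
(* It is enough to follow one tile: its image is a tile, so the images of its vertices differ by
   unit lattice vectors, and these determine the isometry up to a translation. *)
have tile : tiling (triangle 0 (dir R 0) (dir R 1)).
  exists 0, (dir R 0), (dir R 1); split.
    by split; apply/tiling_vertexP => //; exact: lattice_vector_dir.
  by split; rewrite ?dist_dirS ?dist_dir0 // dist_sym dist_dir0.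
have : [set f @` T | T in tiling (R := R)] (f @` triangle 0 (dir R 0) (dir R 1)).
  by exists (triangle 0 (dir R 0) (dir R 1)).
rewrite im => -[p [q [r [[/tiling_vertexP vp /tiling_vertexP vq /tiling_vertexP vr]
  [pq qr rp TE]]]]].
have ftri x : triangle 0 (dir R 0) (dir R 1) x -> triangle p q r (f x).
  by rewrite -TE => tx; exists x.
have f0 : triangle p q r (f 0).
  apply: ftri; exists 0, 0; rewrite ?addr0 !scale0r !addr0.
  by split; rewrite ?lexx ?ler01.
have f1 : triangle p q r (f (dir R 0)).
  apply: ftri; exists 1, 0; rewrite ?addr0 scale0r scale1r subr0 addr0 add0r.
  by split; rewrite ?lexx ?ler01.
have f2 : triangle p q r (f (dir R 1)).
  apply: ftri; exists 0, 1; rewrite ?add0r scale0r scale1r subr0 add0r.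
  by split; rewrite ?lexx ?ler01.
have lattice x y := @unit_triangle_difference R p q r x y pq qr rp.
have lqp := lattice_vectorB vq vp; have lrp := lattice_vectorB vr vp.
have [k k6 fk] : exists2 k, (k < 6)%N & f (dir R 0) - f 0 = dir R k.
  apply: unit_lattice_vector; last by rewrite -dist_sub iso dist_dir0.
  by apply: lattice => //; rewrite iso dist_dir0.
have [m m6 fm] : exists2 m, (m < 6)%N & f (dir R 1) - f 0 = dir R m.
  apply: unit_lattice_vector; last by rewrite -dist_sub iso dist_dir0.
  by apply: lattice => //; rewrite iso dist_dir0.
have dkm : dist (dir R k) (dir R m) = 1.
  by rewrite -fk -fm dist_sub opprB addrA subrK -dist_sub iso dist_dirS.
have fE j x : outward j (f x) = outward j (f 0) +
    (outward 1 x * outward j (dir R k) - outward 0 x * outward j (dir R m)).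
  by rewrite (isometry_dir iso x) fk fm outwardB outwardD !outwardZ addrA.
case: (unit_dirs k6 m6 dkm) => mE.
  exists ((6 - k) %% 6)%N, 1%N; split; [by rewrite ltn_mod | by left |].
  by move=> j x; rewrite fE mE rotation_outward_dir.
exists ((3 + k) %% 6)%N, 5%N; split; [by rewrite ltn_mod | by right |].
by move=> j x; rewrite fE mE reflection_outward_dir.
Qed.

Lemma isomorphic_edge h h' : tight h -> tight h' ->
  isomorphic (hexagon h) (hexagon h') ->
  exists s e, [/\ (s < 6)%N, e = 1%N \/ e = 5%N &
    forall j, edge h' (j + 5) = edge h ((s + e * j) %% 6 + 5)].
Proof.
move=> th th' [f [sym img]]; have [s [e [s6 e15 fE]]] := symmetry_outward sym.
have hE j : h' j = outward j (f 0) + h (s + e * j)%N.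
  apply/le_anti/andP; split.
    have : (f @` hexagon h) (vertex h' j) by rewrite img; exact: vertex_hexagon.
    move=> [q hq /(congr1 (outward j))]; rewrite fE outward_vertex => <-.
    by rewrite lerD2l; exact: hq.
  have : hexagon h' (f (vertex h (s + e * j))).
    by rewrite -img; exists (vertex h (s + e * j)) => //; exact: vertex_hexagon.
  by move/(_ j); rewrite fE outward_vertex.
exists s, e; split=> // j.
have [per _] := th.
have perE := periodic_mod (fun j => edge_periodic j th).
have -> : edge h ((s + e * j) %% 6 + 5) = edge h (s + e * j + 5).
  by rewrite perE [RHS]perE modnDml.
rewrite /edge !hE !outwardSS; case: e15 hE fE => -> _ _.
  by rewrite !mul1n !addnS !addn0; ring.
(* [edge h (j + 5)] is centred at index [j] modulo 6, so reversing the indices only exchanges its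
   outer terms. *)
have -> : (s + 5 * (j + 5) = (s + 5 * j + 5).+2 + 3 * 6)%N by lia.
have -> : (s + 5 * (j + 5).+2 = (s + 5 * j + 5) + 5 * 6)%N by lia.
have -> : (s + 5 * (j + 5).+1 = (s + 5 * j + 5).+1 + 4 * 6)%N by lia.
by rewrite !(periodic_addM per); ring.
Qed.

Definition translation (v : plane R) p : plane R := p + v.

Lemma translation_tiling (v : plane R) T : lattice_vector v -> tiling T ->
  tiling (translation v @` T).
Proof.
move=> lv [p [q [r [[vp vq vr] [pq qr rp ->]]]]].
exists (p + v), (q + v), (r + v); split.
  by split; apply/tiling_vertexP => j; rewrite outwardD rpredD //;
    exact: (tiling_vertexP _).1.
have tr_dist x y : dist (x + v) (y + v) = dist x y.
  by rewrite dist_sub opprD addrACA subrr addr0 -dist_sub.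
split; rewrite ?tr_dist //; apply/seteqP; split=> x.
  move=> [y [s [t [s0 t0 st ->]]] <-]; exists s, t; split=> //.
  by apply: plane_eq; rewrite /translation /= /GRing.scale /=; ring.
move=> [s [t [s0 t0 st ->]]].
exists (p + s *: (q - p) + t *: (r - p)); first by exists s, t.
by apply: plane_eq; rewrite /translation /= /GRing.scale /=; ring.
Qed.

Lemma translation_symmetry (v : plane R) :
  lattice_vector v -> tiling_symmetry (translation v).
Proof.
move=> lv; split.
  by move=> p q; rewrite /translation dist_sub opprD addrACA subrr addr0 -dist_sub.
apply/seteqP; split=> [_ [T tT <-]|T tT]; first exact: translation_tiling.
exists (translation (- v) @` T).
  by apply: translation_tiling => //; exact: lattice_vectorN.
rewrite image_comp; apply/seteqP; split=> x.
  by move=> [y Ty <-]; rewrite /= /translation subrK.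
by move=> Tx; exists x => //; rewrite /= /translation subrK.
Qed.

(** Equal edges mean that [h' - h] satisfies the recurrence of the forms, so it consists of the
    values [outward j v] at one vector [v], which is a lattice vector by integrality. *)
Lemma edge_isomorphic h h' : tight h -> tight h' ->
  (forall j, h j \is a Num.int) -> (forall j, h' j \is a Num.int) ->
  (forall j, (j < 6)%N -> edge h (j + 5) = edge h' (j + 5)) ->
  isomorphic (hexagon h) (hexagon h').
Proof.
move=> th th' hint hint' eE.
have {}eE j : edge h j = edge h' j.
  have perE := periodic_mod (fun j => edge_periodic j th).
  have perE' := periodic_mod (fun j => edge_periodic j th').
  have := eE _ (ltn_pmod (j + 1) (isT : (0 < 6)%N)).
  rewrite perE [in RHS]perE' modnDml -addnA modnDr.
  by rewrite -perE -perE'.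
pose v := vertex (fun j => h' j - h j) 0.
have vE j : h' j - h j = outward j v.
  move: j; apply: hexrec_ext.
  - by move=> j; have := eE j; rewrite /edge; lra.
  - by move=> j; rewrite outwardSS.
  - by rewrite outward_vertex.
  - by rewrite outwardS_vertex.
have lv : lattice_vector v by move=> j; rewrite -vE rpredB.
exists (translation v); split; first exact: translation_symmetry.
apply/seteqP; split=> x.
  move=> [y hy <-] j; rewrite /translation outwardD -vE.
  by have := hy j; lra.
move=> hx; exists (x - v); last by rewrite /translation subrK.
by move=> j; rewrite outwardB -vE; have := hx j; lra.
Qed.

End Invariance.

(** * Signatures of distinguished t-hexagons *)

Section Signature.
Variable R : realType.
Implicit Types (H K : set (plane R)) (h : nat -> R).

Lemma character_closed h (a := entry (character (hexagon h))) : tight h ->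
  (forall j, h j \is a Num.int) ->
  (a 1 + a 2 = a 4 + a 5 /\ a 2 + a 3 = a 5 + a 6)%N.
Proof.
move=> th hint; have aE := character_edge th hint; have [per _] := th.
have h6 : h 6%N = h 0%N := per 0%N; have h7 : h 7%N = h 1%N := per 1%N.
have h8 : h 8%N = h 2%N := per 2%N; have h9 : h 9%N = h 3%N := per 3%N.
have h10 : h 10%N = h 4%N := per 4%N; have h11 : h 11%N = h 5%N := per 5%N.
have h12 : h 12%N = h 0%N by rewrite -h6; exact: per 6%N.
split; apply/eqP; rewrite -(eqr_nat R) !natrD /a !aE // /edge !addSn !add0n;
  by rewrite ?(h12, h11, h10, h9, h8, h7, h6); apply/eqP; ring.
Qed.

Lemma character_perimeter h (a := entry (character (hexagon h))) : tight h ->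
  (forall j, h j \is a Num.int) ->
  perimeter (hexagon h) = (a 1 + a 2 + a 3 + a 4 + a 5 + a 6)%:R.
Proof.
move=> th hint; have aE := character_edge th hint.
rewrite perimeter_hexagon // !natrD /a !aE // !big_ord_recr big_ord0 /=.
have p k : edge h k.+4.+2 = edge h k by rewrite -addn6 edge_periodic.
by rewrite !addSn !add0n !p; ring.
Qed.

Lemma distinguished_hexagon n H (a := entry (character H)) :
  distinguished_thexagons n H ->
  exists h, [/\ tight h, forall j, h j \is a Num.int, H = hexagon h &
    [/\ (a 1 + a 2 = a 4 + a 5)%N, (a 2 + a 3 = a 5 + a 6)%N &
        (a 1 + a 2 + a 3 + a 4 + a 5 + a 6 = 2 * n)%N]].
Proof.
move=> [/thexagonP[h [th hint HE]] _ perH]; exists h; split=> //; subst H.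
have [c1 c2] := character_closed th hint; split=> //.
by apply/eqP; rewrite -(eqr_nat R) -perH character_perimeter.
Qed.

(* The literal [5] of [signature] lives in the semiring [nat]; here it is the
   index [5%N], which [lia] can identify with the other indices. *)
Lemma signatureE H (a := entry (character H)) :
  signature H = ((a 1 - a 3)%N, (a 3 - a 5)%N, a 5%N).
Proof. by []. Qed.

(** If the index permutation preserves parity, it permutes [a 1, a 3, a 5], which are sorted in both
    characters. If it exchanges parities, it changes the sign of [a 4 - a 1], nonnegative for both,
    so opposite sides are equal and the sorted triples agree again. *)
Lemma isomorphic_signature n H K :
  distinguished_thexagons n H -> distinguished_thexagons n K ->
  isomorphic H K -> signature H = signature K.
Proof.
move=> dH dK iso.
have [h [th hint HE [c1 c2 sH]]] := distinguished_hexagon dH.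
have [h' [th' hint' KE [c1' c2' sK]]] := distinguished_hexagon dK.
have [s [e [s6 e15 eE]]] : exists s e, [/\ (s < 6)%N, e = 1%N \/ e = 5%N &
    forall j, (j < 6)%N -> entry (character K) j.+1 =
                           entry (character H) ((s + e * j) %% 6).+1].
  subst H K; have [s [e [s6 e15 eE]]] := isomorphic_edge th th' iso.
  exists s, e; split=> // j j6; apply/eqP; rewrite -(eqr_nat R).
  by rewrite !character_edge ?ltn_mod // eE.
have E0 := eE 0%N isT; have E1 := eE 1%N isT; have E2 := eE 2%N isT.
have E3 := eE 3%N isT; have E4 := eE 4%N isT; have E5 := eE 5%N isT.
case: dH dK => [_ [l1 l2 l3] _] [_ [l1' l2' l3'] _]; rewrite !signatureE /=.
case: e15 E0 E1 E2 E3 E4 E5 => -> {eE}; move: s s6 => [|[|[|[|[|[|//]]]]]] _;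
  rewrite -!multE -!plusE /modn /= => E0 E1 E2 E3 E4 E5; congr (_, _, _); lia.
Qed.

Lemma signature_isomorphic n H K :
  distinguished_thexagons n H -> distinguished_thexagons n K ->
  signature H = signature K -> isomorphic H K.
Proof.
move=> dH dK; rewrite !signatureE => -[s1 s2 s3].
have [h [th hint HE [c1 c2 sH]]] := distinguished_hexagon dH.
have [h' [th' hint' KE [c1' c2' sK]]] := distinguished_hexagon dK.
case: dH dK => [_ [l1 l2 l3] _] [_ [l1' l2' l3'] _].
have eE j : (j < 6)%N -> entry (character H) j.+1 = entry (character K) j.+1.
  by move: j => [|[|[|[|[|[|//]]]]]] _; lia.
subst H K; apply: edge_isomorphic => // j j6.
by rewrite -!character_edge // eE.
Qed.

Lemma signature_weight n H : distinguished_thexagons n H ->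
  exists e, ((signature H).1.1 + 2 * (signature H).1.2 + 3 * (signature H).2
             + 3 * e = n)%N.
Proof.
move=> dH; have [h [th hint HE [c1 c2 sH]]] := distinguished_hexagon dH.
case: dH => [_ [l1 l2 l3] _]; rewrite !signatureE /=.
set a := entry (character H) in c1 c2 sH l1 l2 l3 *.
(* The weight [x + 2 y + 3 z] is [a 1 + a 3 + a 5]; each even-indexed side exceeds its opposite side
   by [2 e]. *)
by exists ((a 4 - a 1)./2)%N; lia.
Qed.

Lemma signature_onto n (x y z e : nat) : (x + 2 * y + 3 * z + 3 * e = n)%N ->
  exists2 H : set (plane R), distinguished_thexagons n H & signature H = (x, y, z).
Proof.
move=> nE.
(* Support values of the hexagon with sides [x + y + z], [z + 2 e], [y + z], [x + y + z + 2 e], [z],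
   [y + z + 2 e], placed with its starting point at the origin. *)
pose s := [:: 0; x + y + z; x + y + 2 * z + 2 * e; y + 2 * z + 2 * e;
           y + z + 2 * e; 0]%N.
pose h j : R := (nth 0%N s (j %% 6))%:R.
have per j : h (j + 6)%N = h j by rewrite /h modnDr.
have hint j : h j \is a Num.int by rewrite /h natr_int.
have th : tight h.
  split=> //; apply: (@periodic6_ind _ _ 0%N) => [i||||||];
    first by rewrite -!addSn !per.
  all: rewrite /= /h /= ?add0r ?addr0.
  - by rewrite ler_nat; lia.
  - by rewrite -natrD ler_nat; lia.
  - by rewrite -natrD ler_nat; lia.
  - by rewrite ler_nat; lia.
  - by rewrite ler0n.
  - by rewrite ler0n.
have aE := character_edge th hint.
have eE j (k : nat) : (j < 6)%N -> edge h (j + 5) = k%:R ->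
    entry (character (hexagon h)) j.+1 = k.
  by move=> j6 ek; apply/eqP; rewrite -(eqr_nat R) aE // ek.
have e0 : entry (character (hexagon h)) 1 = (x + y + z)%N.
  by apply: eE => //; rewrite /edge /h /= !natrD ?natrM; ring.
have e1 : entry (character (hexagon h)) 2 = (z + 2 * e)%N.
  by apply: eE => //; rewrite /edge /h /= !natrD ?natrM; ring.
have e2 : entry (character (hexagon h)) 3 = (y + z)%N.
  by apply: eE => //; rewrite /edge /h /= !natrD ?natrM; ring.
have e3 : entry (character (hexagon h)) 4 = (x + y + z + 2 * e)%N.
  by apply: eE => //; rewrite /edge /h /= !natrD ?natrM; ring.
have e4 : entry (character (hexagon h)) 5 = z.
  by apply: eE => //; rewrite /edge /h /= !natrD ?natrM; ring.
have e5 : entry (character (hexagon h)) 6 = (y + z + 2 * e)%N.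
  by apply: eE => //; rewrite /edge /h /= !natrD ?natrM; ring.
exists (hexagon h); last first.
  by rewrite signatureE e0 e2 e4; congr (_, _, _); lia.
split.
- by apply/thexagonP; exists h.
- by rewrite /distinguished e0 e1 e2 e3 e4 e5; split; lia.
- by rewrite character_perimeter // e0 e1 e2 e3 e4 e5; congr (_%:R); lia.
Qed.

End Signature.

(** * The ideal of [n e(1)], and the bijection *)

Lemma e1_muln n : e1 *+ n = (n, 0%N, 0%N).
Proof. by elim: n => [//|n IH]; rewrite mulrSr IH; congr (_, _, _); exact: addn1. Qed.

Lemma covered_weight v w : covered v w ->
  exists e, (v.1.1 + 2 * v.1.2 + 3 * v.2 + 3 * e = w.1.1 + 2 * w.1.2 + 3 * w.2)%N.
Proof.
move: v w => [[v1 v2] v3] [[w1 w2] w3]; rewrite /covered /to_int3 /X3 !inE /=.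
by case/or4P => /eqP[E1 E2 E3];
  [exists 1%N | exists 0%N | exists 0%N | exists 1%N]; lia.
Qed.

Lemma prec_weight v w : prec v w ->
  exists e, (v.1.1 + 2 * v.1.2 + 3 * v.2 + 3 * e = w.1.1 + 2 * w.1.2 + 3 * w.2)%N.
Proof.
elim=> {v w} [v w /covered_weight //|u v w _ [e1 E1] _ [e2 E2]].
by exists (e1 + e2)%N; lia.
Qed.

Lemma lower_ideal_trans u v w : lower_ideal w v -> lower_ideal v u -> lower_ideal w u.
Proof.
move=> [->//|vw] [->|uv]; first by right.
by right; exact: (Relation_Operators.t_trans _ _ _ _ _ uv vw).
Qed.

Lemma lower_ideal_iter (g : nat -> Lambda3) m :
  (forall i, (i < m)%N -> covered (g i.+1) (g i)) -> lower_ideal (g 0%N) (g m).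
Proof.
elim: m => [|m IH] cov; first by left.
apply: (lower_ideal_trans (IH _)); first by move=> i im; apply: cov; rewrite ltnW.
by right; apply: Relation_Operators.t_step; exact: cov.
Qed.

Lemma lower_idealE n (w : Lambda3) : lower_ideal (e1 *+ n) w <->
  exists e, (w.1.1 + 2 * w.1.2 + 3 * w.2 + 3 * e = n)%N.
Proof.
rewrite e1_muln; split=> [[->|/prec_weight[e E]]|].
- by exists 0%N; rewrite /=; lia.
- by exists e; rewrite E /=; lia.
move: w => [[x y] z] [e /= <-].
have cov (v w : Lambda3) c : c \in X3 -> to_int3 v = to_int3 w + c -> covered v w.
  by rewrite /covered => cX ->; rewrite addrAC subrr add0r.
set n' := (_ + _)%N.
(* The chain descends by [(-2, 1, 0)] taken [y + z + e] times, then [(-1, -1, 1)] taken [z + e]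
   times, then [(0, 0, -1)] taken [e] times; all truncated subtractions are exact. *)
apply: (@lower_ideal_trans _ (n' - 2 * (y + z + e), y + z + e, 0)%N).
  have := @lower_ideal_iter (fun i => (n' - 2 * i, i, 0)%N) (y + z + e).
  rewrite muln0 subn0; apply=> i im.
  by apply: (cov _ _ (-2, 1, 0)) => //; congr (_, _, _) => /=; lia.
apply: (@lower_ideal_trans _ (x, y, z + e)%N).
  have := @lower_ideal_iter
    (fun i => (n' - 2 * (y + z + e) - i, y + z + e - i, i)%N) (z + e).
  have -> : (n' - 2 * (y + z + e) - (z + e) = x)%N by lia.
  have -> : (y + z + e - (z + e) = y)%N by lia.
  rewrite !subn0; apply=> i im.
  by apply: (cov _ _ (-1, -1, 1)) => //; congr (_, _, _) => /=; lia.
have := @lower_ideal_iter (fun i => (x, y, z + e - i)%N) e.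
rewrite addnK subn0; apply=> i im.
by apply: (cov _ _ (0, 0, -1)) => //; congr (_, _, _) => /=; lia.
Qed.

Theorem theorem4p3 (R : realType) (n : nat) :
  exists phi : set (set (plane R)) -> Lambda3,
    (forall H : set (plane R), distinguished_thexagons n H ->
       phi (isomorphism_class (distinguished_thexagons n) H) = signature H) /\
    set_bij (isomorphism_classes (distinguished_thexagons n))
            (lower_ideal (e1 *+ n)) phi.
Proof.
(* The signature of a chosen representative; classes are nonempty, so the default [set0] is never
   returned for want of a member. *)
exists (fun C => signature (xget set0 C)).
have phiE (H : set (plane R)) : distinguished_thexagons n H ->
    signature (xget set0 (isomorphism_class (distinguished_thexagons n) H)) =
    signature H.
  move=> dH; have : isomorphism_class (distinguished_thexagons n) H H.
    by split=> //; exact: (signature_isomorphic dH dH).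
  move=> /(@xgetI _ set0)[dK iso].
  exact/esym/(isomorphic_signature dH dK iso).
split=> //; split.
- move=> _ [H dH <-] /=; rewrite phiE //.
  by apply/lower_idealE; exact: signature_weight.
- move=> C D; rewrite !inE => -[H dH <-] [K dK <-]; rewrite !phiE // => E.
  (* Isomorphism is compared through signatures, which replaces its symmetry and transitivity. *)
  apply/seteqP; split=> L [dL iso]; split=> //.
    apply: (signature_isomorphic dK dL).
    by rewrite -E (isomorphic_signature dH dL iso).
  apply: (signature_isomorphic dH dL).
  by rewrite E (isomorphic_signature dK dL iso).
- move=> [[x y] z] /lower_idealE[e E].
  have [H dH sH] := signature_onto R E.
  exists (isomorphism_class (distinguished_thexagons n) H); first by exists H.
  by rewrite /= phiE.
Qed.
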